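(* There is an algorithm that, given an instance $I=(S,\mathcal{F},k,c,p,B)$ of the budgeted laminar matroid independent set (BLM) problem and $\varepsilon>0$, finds in time $O\left(|I|^5\cdot \varepsilon^{-2}\right)$ a solution $T$ for $I$ of profit $p(T)\geq (1-\varepsilon)\cdot \mathrm{OPT}(I)$.
   Context: A family $\mathcal{F}\subseteq 2^S\setminus\{\emptyset\}$ on a finite set $S$ is laminar if for all $X,Y\in\mathcal{F}$ either $X\cap Y=\emptyset$, $X\subseteq Y$, or $Y\subseteq X$. For a laminar family $\mathcal{F}$ on $S$ and $k:\mathcal{F}\to\mathbb{N}_{>0}$, let $\mathcal{I}_{\mathcal{F},k}=\{A\subseteq S : |A\cap X|\leq k(X)\ \forall X\in\mathcal{F}\}$ (the independent sets of the laminar matroid $(S,\mathcal{I}_{\mathcal{F},k})$). A BLM instance is a tuple $I=(S,\mathcal{F},k,c,p,B)$ where $S$ is a finite set, $\mathcal{F}$ is a laminar family on $S$ with $S\in\mathcal{F}$, $k:\mathcal{F}\to\mathbb{N}_{>0}$, $c:S\to\mathbb{N}$ is a cost function, $p:S\to\mathbb{N}$ is a profit function, and $B\in\mathbb{N}$ is a budget. For $R\subseteq S$ write $c(R)=\sum_{e\in R}c(e)$ and $p(R)=\sum_{e\in R}p(e)$. A solution of $I$ is a set $T\in\mathcal{I}_{\mathcal{F},k}$ with $c(T)\leq B$; $\mathrm{OPT}(I)$ is the maximum of $p(T)$ over all solutions $T$ of $I$. $|I|$ denotes the encoding size of $I$.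
   Formalization: The running time is proved as O(|I|^5·ε^-2 + 1): for ε far larger than |I|^(5/2) the bound without ''+1'' would be less than one step, which no algorithm meets; where |I|^5·ε^-2 ≥ 1 (all ε ≤ 1) the bounds agree. The input ε is a rational number. *)

(* Defs.v *)
From mathcomp Require Import all_boot all_order all_algebra.

Set Implicit Arguments.
Unset Strict Implicit.
Unset Printing Implicit Defensive.

Import Order.TTheory GRing.Theory Num.Theory.

Definition laminar (S : finType) (F : {set {set S}}) : Prop :=
  set0 \notin F /\
  forall X Y, X \in F -> Y \in F ->
    [\/ X :&: Y = set0, X \subset Y | Y \subset X].

(* The values of [cap] outside [fam] are never used. *)
Record blm := BLM {
  ground : finType;
  fam : {set {set ground}};
  cap : {set ground} -> nat;
  cost : ground -> nat;
  profit : ground -> nat;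
  budget : nat;
  fam_laminar : laminar fam;
  fam_ground : [set: ground] \in fam;
  cap_gt0 : forall X, X \in fam -> 0 < cap X
}.

Definition independent (I : blm) (A : {set ground I}) : bool :=
  [forall X in fam I, #|A :&: X| <= cap X].

Definition total_cost (I : blm) (R : {set ground I}) : nat :=
  \sum_(e in R) cost e.

Definition total_profit (I : blm) (R : {set ground I}) : nat :=
  \sum_(e in R) profit e.

Definition solution (I : blm) (T : {set ground I}) : bool :=
  independent T && (total_cost T <= budget I).

(* The empty set is a solution, so this is a maximum over a nonempty range. *)
Definition OPT (I : blm) : nat :=
  \max_(T : {set ground I} | solution T) total_profit T.

Definition label (S : finType) (e : S) : nat := enum_rank e.

(* The family is given explicitly, each member as its capacity, its cardinality
   and the list of the labels of its elements; [Fs] lists the family. *)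
Definition encode (I : blm) (Fs : seq {set ground I}) : seq nat :=
  [:: #|ground I|; size Fs; budget I]
  ++ flatten [seq [:: cost e; profit e] | e <- enum (ground I)]
  ++ flatten [seq [:: cap X, #|X| & [seq label e | e <- enum X]] | X <- Fs].

Definition encodes (I : blm) (w : seq nat) : Prop :=
  exists2 Fs : seq {set ground I}, perm_eq Fs (enum (fam I)) & w = encode Fs.

(* Number of binary digits, with one digit for 0. *)
Definition bit_length (n : nat) : nat := (trunc_log 2 n).+1.

Definition encoding_size (w : seq nat) : nat := \sum_(x <- w) bit_length x.

(* The machine has registers and an indirectly addressed memory, both holding
   natural numbers. The only arithmetic operations are addition and truncated
   subtraction: with multiplication at unit cost on unbounded numbers, the model
   would not be polynomially equivalent to Turing machines. *)

Record state := State { reg : nat -> nat; mem : nat -> nat }.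

Definition upd (f : nat -> nat) (i v : nat) : nat -> nat :=
  fun j => if j == i then v else f j.

Inductive instr :=
  | Const of nat & nat
  | Add of nat & nat & nat
  | Sub of nat & nat & nat
  | Read of nat & nat
  | Write of nat & nat.

Definition step (c : instr) (s : state) : state :=
  let: State r m := s in
  match c with
  | Const i n => State (upd r i n) m
  | Add i j k => State (upd r i (r j + r k)) m
  | Sub i j k => State (upd r i (r j - r k)) m
  | Read i j => State (upd r i (m (r j))) m
  | Write i j => State r (upd m (r i) (r j))
  end.

(* The tests of [If] and [While] ask whether a register is nonzero. *)
Inductive program :=
  | Skip
  | Do of instr
  | Seq of program & program
  | If of nat & program & program
  | While of nat & program.

(* [exec P s t s']: started in [s], the program [P] halts in [s'] after [t] time
   units; every instruction and every evaluation of a test takes one. *)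
Inductive exec : program -> state -> nat -> state -> Prop :=
  | exec_skip s : exec Skip s 1 s
  | exec_do c s : exec (Do c) s 1 (step c s)
  | exec_seq P Q s t s' u s'' :
      exec P s t s' -> exec Q s' u s'' -> exec (Seq P Q) s (t + u) s''
  | exec_if_true i P Q s t s' :
      reg s i != 0 -> exec P s t s' -> exec (If i P Q) s t.+1 s'
  | exec_if_false i P Q s t s' :
      reg s i = 0 -> exec Q s t s' -> exec (If i P Q) s t.+1 s'
  | exec_while_true i P s t s' u s'' :
      reg s i != 0 -> exec P s t s' -> exec (While i P) s' u s'' ->
      exec (While i P) s (t + u).+1 s''
  | exec_while_false i P s :
      reg s i = 0 -> exec (While i P) s 1 s.

(* Input: the numerator and the denominator of [eps] in lowest terms, followed by
   the encoding of the instance, from address 0 on; all else is 0. *)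
Definition input (w : seq nat) (eps : rat) : state :=
  State (fun=> 0) (nth 0 [:: `|numq eps|%N, `|denq eps|%N & w]).

(* Output: [r_0] elements, whose labels are stored from address [r_1] on. *)
Definition outputs (I : blm) (s : state) (T : {set ground I}) : Prop :=
  perm_eq (mkseq (fun i => mem s (reg s 1 + i)) (reg s 0))
          [seq label e | e <- enum T].

(* Main.v *)
(** Rounding the precision to [1/k] with [k = ceil(1/eps)], the machine tries the guesses
    [G = 1, 2, 4, ...] for OPT up to the total profit.  For a guess, profits are scaled to
    [floor(p n k / G)], capped at [2 n k], and a dynamic program over the laminar family,
    processed by increasing cardinality, stores for every component, cardinality and scaled
    profit the cheapest set, coded as the single number [cost * 2^n + bit mask].  Merging two
    components is a (min, +)-convolution of tables addressed by [cardinality * W + profit].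
    For the guess with [G <= OPT < 2 G] rounding loses at most [n G <= n OPT] scaled units,
    i.e. a factor [1 - 1/k]; for larger guesses only sets of scaled profit at least
    [n (k - 1)] are accepted, and these are worth at least [(1 - 1/k) G].  So the set
    accepted last is good enough.  The merges inside a member [X] cost [O((|X| n k)^2)],
    and since every member is listed explicitly, the sum of all [|X|] is at most the
    encoding size. *)
Require Import Defs.
From mathcomp Require Import all_boot all_order all_algebra.
From mathcomp Require Import zify.
Import Order.TTheory GRing.Theory Num.Theory.
Import Defs.

(** Origin of the exponent: the total profit has at most [N] binary digits, where [N] is the
    encoding size, so there are at most [N] guesses; each costs a constant times [(N W)^2], and the
    row width [W = 2nk + 1] is at most [3 N k]. The product is of order [N^5 k^2], and
    [k <= 2 / eps] when [eps < 1]. The machine only adds and subtracts with truncation, and this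
    dictates the data layout. Cells store [K - weight], so that 0, the content of fresh memory,
    means an absent set, minima become maxima, and sets over budget vanish by truncation. Keys and
    weights are additive over disjoint sets, so a merge needs no other arithmetic, and the mask
    inside the weight carries the set itself along, which spares any backtracking. Products,
    quotients and binary digits come from loops. No table is ever released: each is built in zeroed
    memory above all earlier ones. Laminarity ensures that a member contains every earlier component
    it meets, so that its table is assembled from whole components and its capacity is imposed
    afterwards by cutting off rows. *)

Set Implicit Arguments.
Unset Strict Implicit.
Unset Printing Implicit Defensive.

(* [upd] with the concrete comparison of [nat], so that [cbv] can evaluate it. *)
Definition updr (f : nat -> nat) (i v : nat) : nat -> nat :=
  fun j => if eqn j i then v else f j.

(* Registers and memory are passed separately: no projection of an unknown state
   gets in the way of the symbolic evaluation. *)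
Fixpoint runf (cs : seq instr) (r m : nat -> nat) : state :=
  match cs with
  | [::] => State r m
  | c :: cs' =>
    match c with
    | Const i n => runf cs' (updr r i n) m
    | Add i j k => runf cs' (updr r i (r j + r k)) m
    | Sub i j k => runf cs' (updr r i (r j - r k)) m
    | Read i j => runf cs' (updr r i (m (r j))) m
    | Write i j => runf cs' r (upd m (r i) (r j))
    end
  end.

Definition run (cs : seq instr) (s : state) : state := runf cs (reg s) (mem s).

(** * Total correctness with running times and frames *)

(** The postcondition sees the elapsed time, so results and cost bounds are proved together; the
    existential form makes termination part of every specification. *)
Definition wp (P : program) (s : state) (Q : nat -> state -> Prop) : Prop :=
  exists t s', exec P s t s' /\ Q t s'.

Fixpoint block (cs : seq instr) : program :=
  if cs is c :: cs' then Seq (Do c) (block cs') else Skip.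

Definition written (c : instr) : seq nat :=
  match c with
  | Const i _ | Add i _ _ | Sub i _ _ | Read i _ => [:: i]
  | Write _ _ => [::]
  end.

Fixpoint wr (P : program) : seq nat :=
  match P with
  | Skip => [::]
  | Do c => written c
  | Seq P Q | If _ P Q => wr P ++ wr Q
  | While _ P => wr P
  end.

Fixpoint stores (P : program) : bool :=
  match P with
  | Skip => false
  | Do c => if c is Write _ _ then true else false
  | Seq P Q | If _ P Q => stores P || stores Q
  | While _ P => stores P
  end.

(** Read off the program text, so that a loop specification mentions only what the loop changes;
    [frw] recovers all other registers by computation. *)
Definition frame (P : program) (s s' : state) : Prop :=
  (forall i, i \notin wr P -> reg s' i = reg s i) /\
  (~~ stores P -> mem s' = mem s).

Lemma frame_refl P s : frame P s s.
Proof. by []. Qed.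

Lemma frame_trans P s s' s'' : frame P s s' -> frame P s' s'' -> frame P s s''.
Proof.
move=> [r1 m1] [r2 m2]; split=> [i ni|nP]; first by rewrite r2 // r1.
by rewrite m2 // m1.
Qed.

Lemma frame_reg P s s' i : frame P s s' -> i \notin wr P -> reg s' i = reg s i.
Proof. by case=> + _; apply. Qed.

Lemma frame_mem P s s' : frame P s s' -> ~~ stores P -> mem s' = mem s.
Proof. by case=> _; apply. Qed.

Lemma exec_frame P s t s' : exec P s t s' -> frame P s s'.
Proof.
elim=> {P s t s'} //=.
- case=> [i n|i j k|i j k|i j|i j] [r m]; split=> //= l; rewrite ?inE // => /negPf nl;
    by rewrite /upd nl.
- move=> P Q s t s' u s'' _ [r1 m1] _ [r2 m2]; split=> [i|].
    by rewrite mem_cat negb_or => /andP[nP nQ]; rewrite r2 // r1.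
  by rewrite /= negb_or => /andP[nP nQ]; rewrite m2 // m1.
- move=> i P Q s t s' _ _ [r1 m1]; split=> [j|].
    by rewrite mem_cat negb_or => /andP[nP nQ]; rewrite r1.
  by rewrite /= negb_or => /andP[nP nQ]; rewrite m1.
- move=> i P Q s t s' _ _ [r1 m1]; split=> [j|].
    by rewrite mem_cat negb_or => /andP[nP nQ]; rewrite r1.
  by rewrite /= negb_or => /andP[nP nQ]; rewrite m1.
- move=> i P s t s' u s'' _ _ [r1 m1] _ [r2 m2]; split=> [j nj|nP].
    by rewrite r2 // r1.
  by rewrite m2 // m1.
Qed.

Lemma wp_conseq P s (Q R : nat -> state -> Prop) :
  wp P s Q -> (forall t s', frame P s s' -> Q t s' -> R t s') -> wp P s R.
Proof.
move=> [t [s' [e q]]] QR; exists t, s'; split=> //.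
by apply: QR q; apply: exec_frame e.
Qed.

Lemma wp_skip s Q : Q 1 s -> wp Skip s Q.
Proof. by move=> q; exists 1, s; split=> //; constructor. Qed.

Fixpoint block_time (cs : seq instr) : nat :=
  if cs is _ :: cs' then (block_time cs').+1 else 1.

Lemma wp_block cs s Q : Q (block_time cs) (run cs s) -> wp (block cs) s Q.
Proof.
elim: cs s Q => [|c cs IH] s Q q.
  by apply: wp_skip; case: s q.
have [t [s' [e q']]] : wp (block cs) (step c s) (fun t => Q t.+1).
  by apply: IH; case: c s q => [i n|i j k|i j k|i j|i j] [r m].
exists t.+1, s'; split=> //; rewrite -add1n.
by apply: exec_seq e; constructor.
Qed.

Lemma wp_seq P P' s Q :
  wp P s (fun t s' => wp P' s' (fun u => Q (t + u))) -> wp (Seq P P') s Q.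
Proof.
move=> [t [s' [e [u [s'' [e' q]]]]]]; exists (t + u), s''; split=> //.
exact: exec_seq e e'.
Qed.

Lemma wp_if i P P' s Q :
  (reg s i != 0 -> wp P s (fun t => Q t.+1)) ->
  (reg s i = 0 -> wp P' s (fun t => Q t.+1)) -> wp (If i P P') s Q.
Proof.
move=> p p'; have [z|nz] := eqVneq (reg s i) 0.
  by have [t [s' [e q]]] := p' z; exists t.+1, s'; split=> //; apply: exec_if_false.
by have [t [s' [e q]]] := p nz; exists t.+1, s'; split=> //; apply: exec_if_true.
Qed.

(** The exact number [m] of iterations replaces a termination measure. Every iteration receives the
    frame from the initial state, so that invariants need not repeat the values of constant
    registers. *)
Lemma wp_while r body (Inv : nat -> state -> Prop) (T : nat -> nat) m s :
  Inv 0 s ->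
  (forall s', frame body s s' -> Inv m s' -> reg s' r = 0) ->
  (forall i s', i < m -> frame body s s' -> Inv i s' ->
     reg s' r != 0 /\ wp body s' (fun t s'' => t <= T i /\ Inv i.+1 s'')) ->
  wp (While r body) s
     (fun t s' => t <= (\sum_(i < m) (T i).+1).+1 /\ Inv m s').
Proof.
move=> I0 Im Istep.
suff H l i s' : i + l = m -> frame body s s' -> Inv i s' ->
    wp (While r body) s'
      (fun t s'' => t <= (\sum_(i <= j < m) (T j).+1).+1 /\ Inv m s'').
  have := H m 0 s (add0n m) (frame_refl _ _) I0.
  by rewrite big_mkord.
elim: l i s' => [|l IH] i s' eil fr Ii.
  rewrite addn0 in eil; subst i; exists 1, s'; split; last by rewrite big_geq.
  by apply: exec_while_false; apply: Im.
have lt_im : i < m by rewrite -eil -addSnnS leq_addr.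
have [nz [t [s1 [e1 [le1 I1]]]]] := Istep _ _ lt_im fr Ii.
have fr1 := frame_trans fr (exec_frame e1).
have eil1 : i.+1 + l = m by rewrite addSnnS.
have [u [s2 [e2 [le2 I2]]]] := IH _ _ eil1 fr1 I1.
exists (t + u).+1, s2; split; first exact: exec_while_true nz e1 e2.
split=> //; rewrite big_ltn //.
by move: (\sum_(_ <= _ < _) _) le1 le2 => S; lia.
Qed.

Notation rOne := 2 (only parsing).

(** [Sub] has no immediate operand, hence the register [rOne], which holds 1 during the whole
    run. *)
Definition rep (r : nat) (body : program) : program :=
  While r (Seq body (block [:: Sub r r rOne])).

Lemma wp_rep r body (Inv : nat -> state -> Prop) (T : nat -> nat) m s :
  reg s r = m -> reg s rOne = 1 ->
  (r \notin wr body) && (rOne \notin r :: wr body) ->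
  Inv 0 s ->
  (forall i s', i < m -> frame (rep r body) s s' -> reg s' r = m - i -> Inv i s' ->
     wp body s' (fun t s'' => t <= T i /\ Inv i.+1 (run [:: Sub r r rOne] s''))) ->
  wp (rep r body) s
     (fun t s' => [/\ t <= (\sum_(i < m) (T i + 3)).+1, reg s' r = 0 & Inv m s']).
Proof.
move=> rm r1 /andP[nr n1] I0 Istep.
set J := fun i s' => reg s' r = m - i /\ Inv i s'.
have J0 : J 0 s by rewrite /J subn0.
have K1 : rOne \notin wr (rep r body).
  by move: n1; rewrite inE negb_or /= mem_cat !inE negb_or => /andP[-> ->].
apply: wp_conseq (wp_while (m := m) (r := r) (T := fun i => T i + 2) J0 _ _) _.
- by move=> s' _ [-> _]; rewrite subnn.
- move=> i s' im fr [ri Ii]; split; first by rewrite ri -lt0n subn_gt0.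
  apply: wp_seq; apply: wp_conseq (Istep i s' im fr ri Ii) _ => t s1 fr1 [le1 I1].
  apply: wp_block; split; first by rewrite /=; lia.
  split=> //=; rewrite /updr eqnE !eqxx (frame_reg fr1 nr) ri (frame_reg fr1) ?(frame_reg fr) ?r1 //.
    by rewrite -subnDA addn1.
  by move: n1; rewrite inE negb_or => /andP[].
- move=> t s' _ [le1 [r0 Im]]; split=> //; last by rewrite r0 subnn.
  apply: leq_trans le1 _; rewrite ltnS; apply: leq_sum => i _; lia.
Qed.

Lemma wp_repc r body (Inv : nat -> state -> Prop) T m s :
  reg s r = m -> reg s rOne = 1 ->
  (r \notin wr body) && (rOne \notin r :: wr body) ->
  Inv 0 s ->
  (forall i s', i < m -> frame (rep r body) s s' -> reg s' r = m - i -> Inv i s' ->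
     wp body s' (fun t s'' => t <= T /\ Inv i.+1 (run [:: Sub r r rOne] s''))) ->
  wp (rep r body) s
     (fun t s' => [/\ t <= m * (T + 3) + 1, reg s' r = 0 & Inv m s']).
Proof.
move=> rm r1 nr I0 Istep; apply: wp_conseq (wp_rep rm r1 nr I0 Istep) _.
by move=> t s' _ []; rewrite sum_nat_const card_ord addn1.
Qed.

Ltac frw F :=
  repeat match type of F with
  | frame _ ?s ?s' =>
    match goal with |- context [reg s' ?i] => rewrite (@frame_reg _ _ _ i F isT) end
  end;
  try rewrite (frame_mem F isT).

Ltac sim := cbv [run runf updr eqn block_time]; cbn [reg mem]; cbv beta iota delta [eqn].

(** * Products and powers of two by repeated addition *)

Definition mul_loop r d x := rep r (block [:: Add d d x]).

Lemma wp_mul_loop r d x s :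
  uniq [:: r; d; x; rOne] -> reg s rOne = 1 ->
  wp (mul_loop r d x) s (fun t s' => 
    [/\ t <= reg s r * 5 + 1, reg s' d = reg s d + reg s r * reg s x & reg s' r = 0]).
Proof.
rewrite /= !inE !negb_or -!andbA !andbT => /and5P[nrd nrx nr1 ndx /andP[nd1 nx1]] r1.
apply: wp_conseq (wp_repc (T := 2)
  (Inv := fun i s' => reg s' d = reg s d + i * reg s x) erefl r1 _ _ _) _.
- by rewrite /= !inE !negb_or nrd eq_sym nr1 eq_sym nd1.
- by rewrite mul0n addn0.
- move=> i s' im fr ri Ii; apply: wp_block; split=> //=; rewrite /updr eqnE !eqxx.
  rewrite [d == r]eq_sym (negPf nrd) Ii (frame_reg fr) ?mulSn; first by lia.
  by rewrite /= !inE !negb_or eq_sym ndx eq_sym nrx.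
- by move=> t s' _ [].
Qed.

Definition dbl_loop r d := rep r (block [:: Add d d d]).

Lemma wp_dbl_loop r d s :
  uniq [:: r; d; rOne] -> reg s rOne = 1 ->
  wp (dbl_loop r d) s (fun t s' => 
    [/\ t <= reg s r * 5 + 1, reg s' d = reg s d * 2 ^ reg s r & reg s' r = 0]).
Proof.
rewrite /= !inE !negb_or -!andbA !andbT => /and3P[nrd nr1 nd1] r1.
apply: wp_conseq (wp_repc (T := 2)
  (Inv := fun i s' => reg s' d = reg s d * 2 ^ i) erefl r1 _ _ _) _.
- by rewrite /= !inE !negb_or nrd eq_sym nr1 eq_sym nd1.
- by rewrite expn0 muln1.
- move=> i s' im fr ri Ii; apply: wp_block; split=> //=; rewrite /updr eqnE !eqxx.
  by rewrite [d == r]eq_sym (negPf nrd) Ii expnS; lia.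
- by move=> t s' _ [].
Qed.

(** * Tables of the dynamic program, independently of the machine *)

Lemma sum_setU (T : finType) (A B : {set T}) (f : T -> nat) : [disjoint A & B] ->
  \sum_(e in A :|: B) f e = \sum_(e in A) f e + \sum_(e in B) f e.
Proof.
by move=> dAB; rewrite -bigU //; apply: eq_bigl => e; rewrite !inE.
Qed.

Section Tables.

Variables (S : finType) (F : {set {set S}}) (cp : {set S} -> nat).
Variables (W K : nat) (sp wt : S -> nat).

(** A two-dimensional address flattened so as to be additive over disjoint sets: merging two cells
    just adds their addresses. *)
Definition key (A : {set S}) := \sum_(e in A) (W + sp e).
Definition weight (A : {set S}) := \sum_(e in A) wt e.
Definition feasible (P : {set {set S}}) (A : {set S}) :=
  forall Y, Y \in P -> #|A :&: Y| <= cp Y.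
(** The sets for which completeness is claimed. The bound on the scaled profit of all of [A] also
    holds for every [A :&: D], so the key of such a part stays in the row of its cardinality. *)
Definition target (A : {set S}) := feasible F A /\ \sum_(e in A) sp e < W.

(* A cell holds [K - weight A] for some [A] with the given key, and 0 when there is no
   such [A] of weight below [K]: with [K = (budget + 1) 2^n] this drops the sets over
   budget.  Sets with equal keys may differ in cardinality, because the scaled profit is
   not kept below [W]; soundness only needs that a key below [(r + 1) W] forces
   [#|A| <= r], and that the column of a key is at most the scaled profit. *)
Definition table (P : {set {set S}}) (D : {set S}) (L : nat) (f : nat -> nat) :=
  (forall x, x < L -> f x != 0 -> exists A : {set S},
     [/\ A \subset D, key A = x, f x = K - weight A & feasible P A]) /\
  (forall A, target A ->
     key (A :&: D) < L /\ K - weight (A :&: D) <= f (key (A :&: D))).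

Lemma keyE A : key A = #|A| * W + \sum_(e in A) sp e.
Proof. by rewrite /key big_split /= sum_nat_const. Qed.

Lemma key_card A r : key A < r.+1 * W -> #|A| <= r.
Proof.
rewrite keyE => lt; rewrite leqNgt; apply/negP => gt.
have := leq_mul gt (leqnn W); lia.
Qed.

Lemma target_key A D : target A -> key (A :&: D) < #|A :&: D|.+1 * W.
Proof.
move=> [_ lt]; rewrite keyE mulSn addnC ltn_add2r.
by apply: leq_ltn_trans lt; rewrite [X in _ <= X](big_setID D) /= leq_addr.
Qed.

Lemma eq_table P D L f f' : (forall x, x < L -> f x = f' x) ->
  table P D L f -> table P D L f'.
Proof.
move=> ff' [so co]; split=> [x xL|A tA]; last by have [? ?] := co A tA; rewrite -ff'.
by rewrite -ff' //; apply: so.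
Qed.

Lemma table_le P D L f : table P D L f -> forall x, x < L -> f x <= K.
Proof.
move=> [so _] x xL; have [->//|nz] := eqVneq (f x) 0.
by have [A [_ _ -> _]] := so x xL nz; apply: leq_subr.
Qed.

Lemma table_set0 P L f : 0 < L -> f 0 = K -> (forall x, 0 < x < L -> f x = 0) ->
  table P set0 L f.
Proof.
move=> L0 f0 fx; split=> [x xL nz|A _]; last first.
  by rewrite setI0 /key /weight !big_set0 subn0 f0.
exists set0; rewrite sub0set /key /weight !big_set0 subn0.
case: x xL nz => [|x] xL; last by rewrite fx // xL.
by split=> // Y _; rewrite set0I cards0.
Qed.

Lemma table_set1 e f : sp e < W -> f 0 = K -> f (W + sp e) = K - wt e ->
  (forall x, 0 < x < W.*2 -> x != W + sp e -> f x = 0) ->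
  table set0 [set e] W.*2 f.
Proof.
move=> ltW f0 f1 fx; split=> [x xL nz|A _]; last first.
  have [eA|neA] := boolP (e \in A).
    have -> : A :&: [set e] = [set e] by apply/setIidPr; rewrite sub1set.
    rewrite /key /weight !big_set1 f1; split=> //; lia.
  have -> : A :&: [set e] = set0.
    by apply/setP => z; rewrite !inE; case: eqP => [->|]; rewrite ?(negPf neA) ?andbF.
  by rewrite /key /weight !big_set0 subn0 f0; split=> //; lia.
case: x xL nz => [|x] xL nz.
  exists set0; rewrite sub0set /key /weight !big_set0 subn0.
  by split=> // Y; rewrite inE.
exists [set e]; rewrite /key /weight !big_set1.
have [E|ne] := eqVneq x.+1 (W + sp e); first by rewrite E f1; split=> // Y; rewrite inE.
by rewrite fx ?eqxx in nz.
Qed.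

(** With truncated subtraction [(K - u) + (K - v) - K = K - (u + v)], so the max-convolution
    described by [lo] and [up] adds weights. Feasibility splits because a member of [P] inside [D2]
    misses the part in [D1], and any other misses the part in [D2]. *)
Lemma table_merge (P : {set {set S}}) (D1 D2 : {set S}) L1 L2 L f1 f2 f :
  [disjoint D1 & D2] ->
  (forall Y, Y \in P -> Y \subset D2 \/ [disjoint Y & D2]) ->
  (forall A, target A -> key (A :&: (D1 :|: D2)) < L) ->
  (forall x y, x < L1 -> y < L2 -> f1 x + f2 y - K <= f (x + y)) ->
  (forall z, z < L -> f z != 0 -> exists x y,
     [/\ x < L1, y < L2, x + y = z & f z = f1 x + f2 y - K]) ->
  table P D1 L1 f1 -> table P D2 L2 f2 -> table P (D1 :|: D2) L f.
Proof.
move=> dD PD2 keyL lo up t1 t2.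
have le1 := table_le t1; have le2 := table_le t2.
case: t1 t2 => so1 co1 [so2 co2]; split=> [z zL nz|A tA]; last first.
  split; first exact: keyL.
  have [k1 w1] := co1 A tA; have [k2 w2] := co2 A tA.
  have dA : [disjoint A :&: D1 & A :&: D2].
    by apply: disjointW dD; apply: subsetIr.
  rewrite setIUr /key /weight !sum_setU //.
  apply: leq_trans (lo _ _ k1 k2).
  by rewrite /key /weight in w1 w2 *; lia.
have [x [y [xL yL xy E]]] := up z zL nz; rewrite E in nz.
(* No cell exceeds [K], so a pair with a zero cell is truncated to 0: absent sets never
   contribute. *)
have {}nz1 : f1 x != 0 by apply: contraNneq nz => ->; have := le2 _ yL; lia.
have {}nz2 : f2 y != 0 by apply: contraNneq nz => E2; rewrite E2; have := le1 _ xL; lia.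
have [A1 [s1 k1 w1 fe1]] := so1 x xL nz1; have [A2 [s2 k2 w2 fe2]] := so2 y yL nz2.
have dA : [disjoint A1 & A2] by apply: disjointW dD.
exists (A1 :|: A2); split.
- exact: setUSS.
- by rewrite /key sum_setU // -xy -k1 -k2.
- by rewrite E w1 w2 /weight sum_setU //; rewrite /weight in w1 w2; lia.
- move=> Y PY; rewrite setIUl; have [sY|dY] := PD2 Y PY.
    have -> : A1 :&: Y = set0.
      apply/eqP; rewrite setI_eq0; exact: disjointW dD.
    by rewrite set0U; apply: fe2.
  have -> : A2 :&: Y = set0.
    apply/eqP; rewrite setIC setI_eq0; exact: disjointW dY.
  by rewrite setU0; apply: fe1.
Qed.

(** The capacity is imposed by shortening the table: a key below [(r + 1) W] belongs to at most [r]
    elements. No target is lost, since its part in [X] respects the capacity and has its key in the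
    row of its cardinality. *)
Lemma table_cap P X f : X \in F ->
  table P X (#|X|.+1 * W) f -> table (X |: P) X ((minn (cp X) #|X|).+1 * W) f.
Proof.
move=> FX [so co]; split=> [x xL nz|A tA].
  have xL' : x < #|X|.+1 * W.
    by apply: leq_trans xL _; rewrite leq_mul2r ltnS geq_minr orbT.
  have [A [sA kA wA fA]] := so x xL' nz; exists A; split=> // Y.
  rewrite !inE => /orP[/eqP->|]; last exact: fA.
  have : #|A| <= minn (cp X) #|X| by apply: key_card; rewrite kA.
  by rewrite leq_min => /andP[le _]; rewrite (setIidPl sA).
have [_ ?] := co A tA; split=> //.
apply: leq_trans (target_key _ tA) _; rewrite leq_mul2r ltnS leq_min.
by rewrite (proj1 tA) // subset_leq_card ?subsetIr ?orbT.
Qed.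

Lemma table_other P (X D : {set S}) L f : [disjoint D & X] -> table P D L f -> table (X |: P) D L f.
Proof.
move=> dD [so co]; split=> // x xL nz; have [A [sA kA wA fA]] := so x xL nz.
exists A; split=> // Y; rewrite !inE => /orP[/eqP->|]; last exact: fA.
suff -> : A :&: X = set0 by rewrite cards0.
by apply/eqP; rewrite setI_eq0; apply: disjointW dD.
Qed.

End Tables.

(** * Register names and the machine program *)

Notation rZero := 3 (only parsing).
Notation rTwo := 4 (only parsing).
Notation rA := 5 (only parsing).
Notation rD := 6 (only parsing).
Notation rk := 7 (only parsing).
Notation rn := 8 (only parsing).
Notation rf := 9 (only parsing).
Notation rK := 10 (only parsing).
Notation rH := 11 (only parsing).
Notation rV := 12 (only parsing).
Notation rW := 13 (only parsing).
Notation rTh := 14 (only parsing).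
Notation rSum := 15 (only parsing).
Notation rSets := 16 (only parsing).
Notation rTab := 17 (only parsing).
Notation rLen := 18 (only parsing).
Notation rFree := 19 (only parsing).
Notation rBest := 20 (only parsing).
Notation rG := 21 (only parsing).
Notation rc := 22 (only parsing).
Notation rd := 23 (only parsing).
Notation rp := 24 (only parsing).
Notation rx := 25 (only parsing).
Notation ry := 26 (only parsing).
Notation rpw := 27 (only parsing).
Notation rq := 28 (only parsing).
Notation rsp := 29 (only parsing).
Notation ru := 30 (only parsing).
Notation rt := 31 (only parsing).
Notation rpt := 32 (only parsing).
Notation rpl := 33 (only parsing).
Notation rL := 34 (only parsing).
Notation rsz := 35 (only parsing).
Notation rcap := 36 (only parsing).
Notation rcard := 37 (only parsing).
Notation rLX := 38 (only parsing).
Notation racc := 39 (only parsing).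
Notation rlab := 40 (only parsing).
Notation rtb := 41 (only parsing).
Notation rln := 42 (only parsing).
Notation ri := 43 (only parsing).
Notation rxa := 44 (only parsing).
Notation rfo := 45 (only parsing).
Notation rxv := 46 (only parsing).
Notation rj := 47 (only parsing).
Notation rya := 48 (only parsing).
Notation ro := 49 (only parsing).
Notation ryv := 50 (only parsing).
Notation rov := 51 (only parsing).
Notation rR := 52 (only parsing).
Notation rz := 53 (only parsing).

(** A maximum without comparison: [rov + (rxv + ryv - rK - rov)], with truncation, is the larger of
    [rov] and [rxv + ryv - rK]. *)
Definition merge_inner : program := rep rj (block [::
  Read ryv rya; Add rz rxv ryv; Sub rz rz rK; Read rov ro; Sub rz rz rov;
  Add rov rov rz; Write ro rov; Add rya rya rOne; Add ro ro rOne]).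

Definition merge_row : program :=
  Seq (block [:: Read rxv rxa; Add rj rln rZero; Add rya rtb rZero; Add ro rfo rZero])
  (Seq merge_inner (block [:: Add rxa rxa rOne; Add rfo rfo rOne])).

(** The zeros from [rFree] on serve as an empty table. All [rLX + rln] possible sums of addresses
    get room, but only the first [rLX] cells are read later. *)
Definition merge : program :=
  Seq (block [:: Add ri rLX rZero; Add rxa racc rZero; Add rfo rFree rZero])
  (Seq (rep ri merge_row)
       (block [:: Add racc rFree rZero; Add rFree rFree rLX; Add rFree rFree rln])).

Definition label_body : program :=
  Seq (block [:: Read rlab rp; Add rp rp rOne; Add rpt rTab rlab; Add rpl rLen rlab;
                 Read rtb rpt])
      (If rtb (Seq (block [:: Write rpt rZero; Read rln rpl]) merge) Skip).

Definition cap_body : program :=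
  If rcap (block [:: Add rL rL rW; Add rR rR rOne; Sub rcap rcap rOne]) Skip.

(** Each absorbed component has its directory slot cleared. After the loop [rpt] and [rpl] still
    point to the slots of the last label of the member, and there the new table is registered. *)
Definition process : program :=
  Seq (block [:: Add rLX rW rZero; Add ry rcard rZero])
  (Seq (mul_loop ry rLX rW)
  (Seq (block [:: Write rFree rK; Add racc rFree rZero; Add rFree rFree rLX;
                  Add ry rcard rZero])
  (Seq (rep ry label_body)
  (Seq (block [:: Add rL rW rZero; Const rR 1; Add ry rcard rZero])
  (Seq (rep ry cap_body)
       (block [:: Write rpt racc; Write rpl rL])))))).

(** [ru] is the absolute difference of [rcard] and [rsz], as a sum of two truncated differences: it
    vanishes exactly for members of the current cardinality. *)
Definition set_body : program :=
  Seq (block [:: Read rcap rp; Add rp rp rOne; Read rcard rp; Add rp rp rOne;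
                 Sub ru rcard rsz; Sub rt rsz rcard; Add ru ru rt])
      (If ru (block [:: Add rp rp rcard]) process).

(** Rescanning the whole list once per cardinality replaces sorting; the extra cost is only of order
    [n] times the size of the family. *)
Definition size_body : program :=
  Seq (block [:: Add rp rSets rZero; Add rd rf rZero])
  (Seq (rep rd set_body) (block [:: Add rsz rsz rOne])).

(** One step of a division by repeated subtraction; repeating it [rV] times also caps the quotient
    at [rV]. *)
Definition scale_body : program :=
  Seq (block [:: Add ru rq rOne; Sub ru ru rG])
      (If ru (block [:: Sub rq rq rG; Add rsp rsp rOne]) Skip).

Definition element_body : program :=
  Seq (block [:: Read rx rp; Add rp rp rOne; Read ry rp; Add rp rp rOne;
                 Add rd rn rZero])
  (Seq (dbl_loop rd rx)
  (Seq (block [:: Add rx rx rpw; Add rpw rpw rpw; Const rq 0; Add rd rH rZero])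
  (Seq (mul_loop rd rq ry)
  (Seq (block [:: Const rsp 0; Add rd rV rZero])
  (Seq (rep rd scale_body)
       (block [:: Write rFree rK; Add rt rFree rW; Add rt rt rsp; Sub ru rK rx;
                  Write rt ru; Write rpt rFree; Add rL rW rW; Write rpl rL;
                  Add rFree rFree rL; Add rpt rpt rOne; Add rpl rpl rOne])))))).

Definition row_body : program :=
  Seq (block [:: Read ru ry])
  (Seq (If ru (block [:: Add rBest ru rZero]) Skip) (block [:: Add ry ry rW])).

(** Columns are visited by increasing scaled profit and every nonzero cell overwrites [rBest], so a
    cell of the highest nonempty column survives; if there is none, the result of the earlier
    guesses is kept. *)
Definition column_body : program :=
  Seq (block [:: Add ry rx rZero; Add rd rR rZero])
  (Seq (rep rd row_body) (block [:: Add rx rx rOne])).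

Definition guess_body : program :=
  Seq (block [:: Add rc rn rZero; Const rp 5; Add rpt rTab rZero; Add rpl rLen rZero;
                 Const rpw 1])
  (Seq (rep rc element_body)
  (Seq (block [:: Const rsz 1; Add rc rn rZero])
  (Seq (rep rc size_body)
  (Seq (block [:: Add rx racc rTh; Sub rc rW rTh])
  (Seq (rep rc column_body)
       (block [:: Add rG rG rG; Sub rD rSum rG])))))).

Definition power_body : program :=
  block [:: Write rp rpw; Add rp rp rOne; Add rc rc rOne; Add rpw rpw rpw;
            Sub rD rG rpw].

(** Digits are split off from the top by comparison with the stored powers of two. Positions from
    [rn] on belong to the cost: they are subtracted but not output. *)
Definition digit_body : program :=
  Seq (block [:: Sub rp rp rOne; Read rpw rp; Sub rt rc rOne; Add ru rx rOne; Sub ru ru rpw])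
  (If ru (Seq (block [:: Sub rx rx rpw; Sub ru rn rt])
              (If ru (block [:: Write rq rt; Add rq rq rOne; Add 0 0 rOne]) Skip))
         Skip).

Definition decode : program :=
  Seq (block [:: Sub rx rK rBest; Add rG rx rOne; Const rpw 1; Const rc 0;
                 Add rp rFree rZero; Sub rD rG rpw])
  (Seq (While rD power_body)
  (Seq (block [:: Add 1 rp rZero; Add rq rp rZero])
       (rep rc digit_body))).

(** [rD] starts at denominator minus numerator and [rk] at 1, so counting subtractions yields the
    ceiling of [1/eps]. [rSum] starts at 1, which makes [rSum - rG] nonzero exactly while the guess
    is at most the total profit. *)
Definition setup : program :=
  Seq (block [:: Const rk 1; Const rTwo 2; Read rn rTwo; Const rt 3; Read rf rt;
                 Const rt 4; Read rK rt; Add rK rK rOne])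
  (Seq (While rD (block [:: Sub rD rD rA; Add rk rk rOne]))
  (Seq (block [:: Add rc rk rZero])
  (Seq (mul_loop rc rH rn)
  (Seq (block [:: Add rV rH rH; Add rW rV rOne; Sub rTh rH rn; Add rc rn rZero])
  (Seq (dbl_loop rc rK)
  (Seq (block [:: Const rp 6; Const rSum 1; Add rc rn rZero])
  (Seq (rep rc (block [:: Read rx rp; Add rSum rSum rx; Add rp rp rTwo]))
  (Seq (block [:: Sub rSets rp rOne; Add rp rSets rZero; Add rc rf rZero])
  (Seq (rep rc (block [:: Add rt rp rOne; Read rx rt; Add rp rp rx; Add rp rp rTwo]))
       (block [:: Add rTab rp rZero; Add rLen rTab rn; Add rFree rLen rn;
                  Add rBest rK rZero; Const rG 1; Sub rD rSum rG])))))))))).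

Definition main : program :=
  Seq (block [:: Const rOne 1; Read rA rZero; Read rD rOne; Sub rD rD rA])
      (If rD (Seq setup (Seq (While rD guess_body) decode)) Skip).

(** * Correctness and cost of a merge *)

(** The area read ends before the area written, so all values read are those of the initial
    memory. *)
Lemma wp_merge_inner s ln : reg s rj = ln -> reg s rOne = 1 ->
  reg s rya + ln <= reg s ro ->
  wp merge_inner s (fun t s' => t <= ln * 13 + 1 /\
    forall a, mem s' a =
      if reg s ro <= a < reg s ro + ln
      then maxn (mem s a) (reg s rxv + mem s (reg s rya + (a - reg s ro)) - reg s rK)
      else mem s a).
Proof.
move=> hln h1 le.
apply: wp_conseq (wp_repc (T := 10) (Inv := fun j s' =>
  [/\ reg s' rya = reg s rya + j, reg s' ro = reg s ro + j &
   forall a, mem s' a =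
      if reg s ro <= a < reg s ro + j
      then maxn (mem s a) (reg s rxv + mem s (reg s rya + (a - reg s ro)) - reg s rK)
      else mem s a]) hln h1 _ _ _) _ => //.
- by split=> [||a]; rewrite ?addn0 //; case: ifP => //; lia.
- move=> j s' jl fr _ [ya o m]; apply: wp_block; sim; split=> //.
  frw fr; rewrite h1 ya o; split; try lia.
  move=> a; rewrite /upd !m.
  have -> : (reg s ro <= reg s rya + j < reg s ro + j) = false by lia.
  have -> : (reg s ro <= reg s ro + j < reg s ro + j) = false by lia.
  case: eqP => [->|ne]; last by congr (if _ then _ else _); lia.
  have -> : (reg s ro <= reg s ro + j < reg s ro + j.+1) = true by lia.
  by rewrite addKn; lia.
- by move=> t s' fr [le1 _ [_ _ m]]; split; first lia.
Qed.

Lemma wp_merge s LX ln acc tb free K :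
  reg s rOne = 1 -> reg s rZero = 0 -> reg s rLX = LX -> reg s rln = ln ->
  reg s racc = acc -> reg s rtb = tb -> reg s rFree = free -> reg s rK = K ->
  acc + LX <= free -> tb + ln <= free -> (forall a, free <= a -> mem s a = 0) ->
  wp merge s (fun t s' => 
    [/\ t <= 25 * (LX * ln.+1) + 10,
        reg s' racc = free /\ reg s' rFree = free + LX + ln,
        forall a, a < free -> mem s' a = mem s a,
        forall a, free + LX + ln <= a -> mem s' a = 0 &
        (forall x y, x < LX -> y < ln ->
           mem s (acc + x) + mem s (tb + y) - K <= mem s' (free + (x + y))) /\
        (forall z, mem s' (free + z) != 0 -> exists x y,
           [/\ x < LX, y < ln, x + y = z &
               mem s' (free + z) = mem s (acc + x) + mem s (tb + y) - K])]).
Proof.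
move=> h1 h0 hLX hln hacc htb hfree hK leacc letb m0.
apply: wp_seq; apply: wp_block; sim; rewrite h0 hLX hacc hfree !addn0.
set s1 := State _ _.
apply: wp_seq.
apply: wp_conseq (wp_repc (s := s1) (m := LX) (T := 13 * ln + 9) (Inv := fun i s' =>
  [/\ reg s' rxa = acc + i, reg s' rfo = free + i,
      forall a, (a < free) || (free + i + ln <= a) -> mem s' a = mem s a,
      forall x y, x < i -> y < ln ->
        mem s (acc + x) + mem s (tb + y) - K <= mem s' (free + (x + y)) &
      forall z, mem s' (free + z) != 0 -> exists x y,
        [/\ x < i, y < ln, x + y = z &
            mem s' (free + z) = mem s (acc + x) + mem s (tb + y) - K]]) _ _ _ _ _) _;
  rewrite //.
- rewrite /s1; sim; rewrite !addn0; split=> // z.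
  by rewrite m0 ?leq_addr.
- move=> i s2 iL fr _ [xa fo ms lo up].
  apply: wp_seq; apply: wp_block; sim; frw fr; rewrite /s1; sim.
  rewrite xa fo htb hln h0 !addn0.
  set s3 := State _ _.
  apply: wp_seq; apply: wp_conseq (wp_merge_inner (s := s3) (ln := ln) _ _ _) _;
    rewrite //.
  - by rewrite /s3; sim; frw fr.
  - by rewrite /s3; sim; lia.
  move=> t s4 fr4 [le4 m4]; apply: wp_block; sim; split; first lia.
  frw fr4; rewrite /s3; sim; frw fr; rewrite /s1; sim; rewrite h1 xa fo.
  have {}m4 a : mem s4 a = if free + i <= a < free + i + ln
      then maxn (mem s2 a) (mem s (acc + i) + mem s (tb + (a - (free + i))) - K)
      else mem s2 a.
    rewrite m4 /s3; sim; frw fr; rewrite /s1; sim; rewrite hK.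
    case: ifP => // aP; congr (maxn _ (_ + _ - _)); rewrite ms //; lia.
  split; try lia.
  - move=> a aP; rewrite m4.
    by case: ifP => [|_]; [lia|apply: ms; lia].
  - move=> x y; rewrite ltnS leq_eqVlt => /orP[/eqP->|xi] yl; rewrite m4.
      have -> : free + i <= free + (i + y) < free + i + ln by lia.
      by rewrite (_ : free + (i + y) - (free + i) = y) ?leq_maxr //; lia.
    by case: ifP => _; rewrite ?leq_max lo.
  - move=> z; rewrite m4; case: ifP => [zP|_]; last first.
      by move/up=> [x [y [? ? ? E]]]; exists x, y; split=> //; lia.
    rewrite /maxn; case: ifP => _ nz.
      exists i, (z - i); split; try lia.
      by rewrite (_ : free + z - (free + i) = z - i) //; lia.
    by have [x [y [? ? ? E]]] := up z nz; exists x, y; split=> //; lia.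
- move=> t s2 fr [le2 _ [xa fo ms lo up]].
  apply: wp_block; sim; frw fr; rewrite /s1; sim; rewrite h0 hLX hln hfree addn0.
  split=> //; first nia.
  - by move=> a aP; apply: ms; rewrite aP.
  - by move=> a aP; rewrite ms ?aP ?orbT // m0 //; lia.
Qed.

(** * Processing one member of the family *)

Lemma label_lt (S : finType) (e : S) : label e < #|S|.
Proof. exact: ltn_ord. Qed.

Lemma label_inj (S : finType) : injective (@label S).
Proof. by move=> e e' /ord_inj /enum_rank_inj. Qed.

Section Process.

Variables (S : finType) (F : {set {set S}}) (cp : {set S} -> nat).
Variables (W K : nat) (sp wt : S -> nat) (TA LA : nat).
Hypothesis lamF : laminar F.
Hypothesis W_gt0 : 0 < W.
Hypothesis LAE : LA = TA + #|S|.

Local Notation table := (table F cp W K sp wt).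

(* The word at [TA + label e] is the address of the table of the component represented
   by [e], or 0 if [e] represents none; the word at [LA + label e] is its length. *)
Definition alive (m : nat -> nat) (e : S) : bool := m (TA + label e) != 0.

(** The domains partition [S]. That each is a singleton or a processed member is what laminarity
    needs in order to exclude a partial overlap with the next member. *)
Definition components (P : {set {set S}}) (m : nat -> nat) (free : nat)
    (dom : S -> {set S}) : Prop :=
  [/\ forall e, alive m e ->
        [/\ e \in dom e, dom e = [set e] \/ dom e \in P,
            LA + #|S| <= m (TA + label e) /\ m (TA + label e) + m (LA + label e) <= free &
            m (LA + label e) <= #|dom e|.+1 * W],
      forall e, alive m e ->
        table P (dom e) (m (LA + label e)) (fun x => m (m (TA + label e) + x)),
      forall z, exists2 e, alive m e & z \in dom e,
      forall e e' z, alive m e -> alive m e' -> z \in dom e -> z \in dom e' -> e = e' &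
      forall Y, Y \in P -> exists2 e, alive m e & Y \subset dom e].

Section Step.

Variables (P : {set {set S}}) (X : {set S}) (m0 : nat -> nat) (free0 : nat).
Variable dom : S -> {set S}.
Hypothesis FX : X \in F.
Hypothesis nPX : X \notin P.
Hypothesis PF : P \subset F.
Hypothesis Psmall : forall Y, Y \in P -> #|Y| <= #|X|.
Hypothesis comps : components P m0 free0 dom.

Local Notation alive0 := (alive m0).

(** A domain that is a processed member and meets [X] is comparable with [X] by laminarity. If it
    contained [X], it would equal [X] by cardinality, but [X] is not processed yet; hence the order
    by increasing cardinality. *)
Lemma dom_sub e z : alive0 e -> z \in dom e -> z \in X -> dom e \subset X.
Proof.
move=> ae ze zX; have [/(_ _ ae) [ee [E|Pe] _ _] _ _ _ _] := comps.
  by move: ze; rewrite E inE => /eqP<-; rewrite sub1set.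
have [_ /(_ _ _ (subsetP PF _ Pe) FX) [E|//|]] := lamF.
  by have := in_set0 z; rewrite -E inE ze zX.
move=> sub; have: dom e == X by rewrite eq_sym eqEcard sub Psmall.
by move=> /eqP E; rewrite E (negPf nPX) in Pe.
Qed.

Lemma dom_self e : alive0 e -> e \in X -> dom e \subset X.
Proof. by move=> ae; apply: dom_sub => //; have [/(_ _ ae) []] := comps. Qed.

Lemma dom_out e : alive0 e -> e \notin X -> [disjoint dom e & X].
Proof.
move=> ae; apply: contraR => /pred0Pn[z /andP[/= ze zX]].
by apply: (subsetP (dom_sub ae ze zX)); have [/(_ _ ae) []] := comps.
Qed.

Definition merged (l : seq S) : {set S} := \bigcup_(e <- l | alive0 e) dom e.

Lemma merged_rcons l e :
  merged (rcons l e) = if alive0 e then merged l :|: dom e else merged l.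
Proof. by rewrite /merged big_rcons; case: (alive0 e); rewrite /= ?setU0. Qed.

Lemma mem_merged l z :
  reflect (exists e, [/\ e \in l, alive0 e & z \in dom e]) (z \in merged l).
Proof.
rewrite /merged; apply: (iffP idP) => [|[e [el ae ze]]].
  rewrite big_seq_cond; elim/big_rec: _ => [|e A /andP[el ae] IH]; first by rewrite inE.
  by rewrite inE => /orP[ze|]; [exists e|].
by rewrite (big_rem e) //= ae inE ze.
Qed.

Lemma merged_enum : merged (enum X) = X.
Proof.
apply/setP => z; apply/mem_merged/idP => [[e [eX ae ze]]|zX].
  by rewrite mem_enum in eX; apply: (subsetP (dom_self ae eX)).
have [_ _ /(_ z) [e ae ze] _ _] := comps; exists e; split=> //.
have := subsetP (dom_sub ae ze zX) e; rewrite mem_enum; apply.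
by have [/(_ _ ae) []] := comps.
Qed.

(** The representatives lying in [X] have domains that partition [X]. So the merges, each linear in
    the size of the absorbed domain, add up to a cost quadratic in [#|X|]. *)
Lemma sum_dom : \sum_(e in X | alive0 e) #|dom e| = #|X|.
Proof.
have -> : #|X| = \sum_(z in X) 1 by rewrite sum1_card.
under eq_bigr => e _ do rewrite -sum1_card.
rewrite (exchange_big_dep (fun z => z \in X)) /=; last first.
  by move=> e z /andP[eX ae] ze; apply: (subsetP (dom_self ae eX)).
apply: eq_bigr => z zX; have [H _ /(_ z) [e ae ze] uq _] := comps.
rewrite (big_pred1 e) // => e' /=; apply/idP/eqP => [/andP[/andP[_ ae'] ze']|->].
  exact: uq ze' ze.
rewrite ae ze !andbT; apply: (subsetP (dom_sub ae ze zX)).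
by have [] := H _ ae.
Qed.

Lemma merged_disjoint l e : e \notin l -> alive0 e -> [disjoint merged l & dom e].
Proof.
move=> nl ae; apply/pred0P => z /=; apply/negP => /andP[/mem_merged[e' [el ae' ze']] ze].
have [_ _ _ uq _] := comps.
by move: nl; rewrite -(uq _ _ _ ae' ae ze' ze) el.
Qed.

Lemma done_disjoint Y e : Y \in P -> alive0 e -> Y \subset dom e \/ [disjoint Y & dom e].
Proof.
move=> PY ae; have [_ _ _ uq /(_ Y PY) [e' ae' sub]] := comps.
have [->|ne] := eqVneq e e'; [by left | right].
apply: disjointWl sub _; apply/pred0P => z /=; apply/negP => /andP[ze' ze].
by move/eqP: ne; apply; apply: uq ze ze'.
Qed.

(** The condition on [rpt] and [rpl] starts with the first label; [i.-1] is then the position last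
    visited. Below [free0] only the slots of visited labels differ from [m0]. *)
Definition labels_inv x0 p LX i (s : state) : Prop :=
  let l := take i (enum X) in
  [/\ reg s rp = p + i,
      free0 <= reg s racc /\ reg s racc + LX <= reg s rFree,
      0 < i -> reg s rpt = TA + label (nth x0 (enum X) i.-1) /\
               reg s rpl = LA + label (nth x0 (enum X) i.-1),
      (forall a, a < free0 ->
         mem s a = if a \in [seq TA + label e | e <- l] then 0 else m0 a) /\
      (forall a, reg s rFree <= a -> mem s a = 0) &
      table P (merged l) LX (fun x => mem s (reg s racc + x))].

Lemma mem_tab_addr (l : seq S) e : (TA + label e \in [seq TA + label e | e <- l]) = (e \in l).
Proof.
by rewrite (mem_map (f := fun e => TA + label e)) // => a b /addnI /label_inj.
Qed.

Lemma notin_tab_addr (l : seq S) a : (a < TA) || (LA <= a) ->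
  a \in [seq TA + label e | e <- l] = false.
Proof.
move=> aP; apply/negP => /mapP[e _ E]; have := label_lt e.
by move: aP; rewrite E LAE; lia.
Qed.

Lemma wp_labels x0 s p LX :
  reg s rOne = 1 -> reg s rZero = 0 -> reg s rTab = TA -> reg s rLen = LA ->
  reg s rK = K -> reg s rLX = LX -> reg s ry = #|X| -> LX = #|X|.+1 * W ->
  p + #|X| <= TA -> (forall j, j < #|X| -> m0 (p + j) = label (nth x0 (enum X) j)) ->
  LA + #|S| <= free0 -> labels_inv x0 p LX 0 s ->
  wp (rep ry label_body) s (fun t s' =>
    t <= 27 * #|X| + 150 * (#|X| * W) ^ 2 + 1 /\ labels_inv x0 p LX #|X| s').
Proof.
move=> h1 h0 hTA hLA hK hLX hy LXE pTA hp lefree I0.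
pose el i := nth x0 (enum X) i.
(* The cost is read off the initial memory [m0]: the labels of [X] are distinct, so the slots of the
   current one are still untouched. *)
pose T i := 24 + (if alive0 (el i) then 25 * (LX * (m0 (LA + label (el i))).+1) else 0).
apply: wp_conseq (wp_rep (T := T) (Inv := labels_inv x0 p LX) hy h1 _ I0 _) _ => //.
- move=> i s1 iX fr _ [hrp [leacc lefr] _ [ms mz] tb].
  have lt_sz : i < size (enum X) by rewrite -cardE.
  have eX : el i \in X by rewrite -mem_enum mem_nth.
  have tkE : take i.+1 (enum X) = rcons (take i (enum X)) (el i) by rewrite (take_nth x0).
  have ntk : el i \notin take i (enum X).
    by have: uniq (take i.+1 (enum X)) by [apply: take_uniq; apply: enum_uniq];
      rewrite tkE rcons_uniq => /andP[].
  have llt := label_lt (el i).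
  have rd1 : mem s1 (p + i) = label (el i).
    by rewrite ms; [rewrite notin_tab_addr ?hp //; lia | lia].
  have rd2 : mem s1 (TA + label (el i)) = m0 (TA + label (el i)).
    by rewrite ms ?mem_tab_addr ?(negPf ntk) //; lia.
  have rd3 : mem s1 (LA + label (el i)) = m0 (LA + label (el i)).
    by rewrite ms ?notin_tab_addr //; lia.
  apply: wp_seq; apply: wp_block; sim; frw fr.
  rewrite hrp hTA hLA h1 rd1 rd2.
  apply: wp_if; sim; [move=> ae | move=> de]; last first.
    apply: wp_skip; split; first by rewrite /T; case: ifP.
    sim; split=> //; sim; frw fr; first lia.
      split; last exact: mz.
      move=> a aP; rewrite ms // tkE map_rcons mem_rcons inE.
      by case: eqP => // ->; rewrite de; case: ifP.
    by rewrite tkE merged_rcons /alive -/(el i) de eqxx.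
  have {}ae : alive0 (el i) by [].
  have [/(_ _ ae) [_ _ [tb1 tb2] ln1] /(_ _ ae) tabe _ _ _] := comps.
  apply: wp_seq; apply: wp_block; sim; frw fr; rewrite h0.
  have -> : upd (mem s1) (TA + label (el i)) 0 (LA + label (el i)) = m0 (LA + label (el i)).
    by rewrite /upd -{1}rd3; case: eqP => //; lia.
  set s2 := State _ _.
  have m2 a : mem s2 a = if a == TA + label (el i) then 0 else mem s1 a by [].
  have m2e a : a < free0 ->
      mem s2 a = if a \in [seq TA + label e | e <- take i.+1 (enum X)] then 0 else m0 a.
    move=> aP; rewrite m2 tkE map_rcons mem_rcons inE.
    by case: eqP => //= _; rewrite ms.
  have m2f a : free0 <= a -> mem s2 a = mem s1 a.
    by move=> aP; rewrite m2; case: eqP => // E; lia.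
  have [g1 g0 gLX gln gK] : [/\ reg s2 rOne = 1, reg s2 rZero = 0, reg s2 rLX = LX,
      reg s2 rln = m0 (LA + label (el i)) & reg s2 rK = K].
    by rewrite /s2; sim; frw fr.
  have [gacc gtb gfree] : [/\ reg s2 racc = reg s1 racc,
      reg s2 rtb = m0 (TA + label (el i)) & reg s2 rFree = reg s1 rFree] by [].
  have [gp gpt gpl] : [/\ reg s2 rp = p + i + 1, reg s2 rpt = TA + label (el i) &
     reg s2 rpl = LA + label (el i)] by [].
  clearbody s2.
  have le0 : free0 <= reg s1 rFree by lia.
  apply: wp_conseq (wp_merge g1 g0 gLX gln gacc gtb gfree gK lefr _ _) _.
  - by apply: leq_trans le0.
  - by move=> a aP; rewrite m2f ?mz // (leq_trans le0).
  move=> t s3 fr3 [le3 [acc3 free3] lo3 hi3 [low up]].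
  split; first by rewrite /T ae; lia.
  sim; split; sim; rewrite ?acc3 ?free3.
  - by frw fr3; rewrite gp; lia.
  - by split; lia.
  - by frw fr3; rewrite gpt gpl.
  - split=> a aP; last by apply: hi3.
    by rewrite lo3 ?m2e // (leq_trans aP).
  rewrite tkE merged_rcons ae.
  have tab1 : table P (merged (take i (enum X))) LX (fun x => mem s2 (reg s1 racc + x)).
    by apply: eq_table tb => x xL; rewrite m2f //; lia.
  have tab2 : table P (dom (el i)) (m0 (LA + label (el i)))
      (fun x => mem s2 (m0 (TA + label (el i)) + x)).
    apply: eq_table tabe => x xL; rewrite m2e ?notin_tab_addr //; lia.
  apply: table_merge tab1 tab2 => //.
  - exact: merged_disjoint.
  - by move=> Y PY; apply: done_disjoint.
  (* All that has been merged lies inside [X], so the part of a target has at most [#|X|] elements: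
     the accumulator never needs more than [LX] cells. *)
  - move=> A tA; apply: leq_trans (target_key _ tA) _; rewrite LXE leq_mul2r ltnS.
    rewrite subset_leq_card ?orbT // subIset //; apply/orP; right.
    rewrite -{2}merged_enum subUset; apply/andP; split; apply/subsetP => z.
      move=> /mem_merged[e [el_e ae' ze]]; apply/mem_merged; exists e; split=> //.
      exact: mem_take el_e.
    by move=> ze; apply/mem_merged; exists (el i); rewrite mem_enum.
  - by move=> z _; apply: up.
- move=> t s1 fr [le1 _ I1]; split=> //; apply: leq_trans le1 _.
  rewrite -(big_mkord xpredT (fun i => T i + 3)) cardE -(big_nth x0 xpredT
    (fun e => 24 + (if alive0 e then 25 * (LX * (m0 (LA + label e)).+1) else 0) + 3)).
  rewrite big_enum /= -?cardE.
  (* As a domain is nonempty, its table length plus one is at most [3 * (W * #|dom e|)], whence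
     [75 = 25 * 3]; below, [#|X|.+1 <= 2 * #|X|] turns this into 150. *)
  have le e : e \in X -> 24 + (if alive0 e then 25 * (LX * (m0 (LA + label e)).+1) else 0) + 3
      <= 27 + (if alive0 e then 75 * (LX * W) * #|dom e| else 0).
    move=> eX; case: ifP => // ae; have [/(_ _ ae) [ee _ _ ln1] _ _ _ _] := comps.
    have d0 : 0 < #|dom e| by apply/card_gt0P; exists e.
    have : (m0 (LA + label e)).+1 <= 3 * (W * #|dom e|) by nia.
    move: (m0 _) => ln; nia.
  apply: leq_trans (_ : (\sum_(e in X)
    (27 + (if alive0 e then 75 * (LX * W) * #|dom e| else 0))).+1 <= _).
    by rewrite ltnS; apply: leq_sum.
  rewrite big_split /= sum_nat_const -big_mkcondr -big_distrr /= sum_dom.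
  have X0 : 0 < #|X|.
    by case: lamF => nF _; rewrite card_gt0; apply: contraNneq nF => <-.
  rewrite LXE expnS expn1; move: #|X| X0 => c c0.
  have /leq_mul /(_ (leqnn (W * W * c))) : c.+1 <= 2 * c by lia.
  lia.
Qed.

Lemma wp_cap_loop s c C : reg s rOne = 1 -> reg s rZero = 0 -> reg s ry = c ->
  reg s rcap = C -> reg s rL = W -> reg s rR = 1 -> reg s rW = W ->
  wp (rep ry cap_body) s (fun t s' =>
    [/\ t <= c * 8 + 1, reg s' rL = (minn C c).+1 * W & reg s' rR = (minn C c).+1]).
Proof.
move=> h1 h0 hy hC hL hR hW.
apply: wp_conseq (wp_repc (T := 5) (Inv := fun i s' => [/\ reg s' rcap = C - i,
  reg s' rL = (minn C i).+1 * W & reg s' rR = (minn C i).+1]) hy h1 _ _ _) _ => //.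
- by rewrite minn0 subn0 mul1n.
- move=> i s1 _ fr _ [gC gL gR]; apply: wp_if => nz.
    apply: wp_block; sim; split=> //; frw fr; rewrite h1 hW gC gL gR.
    have E : minn C i.+1 = (minn C i).+1 by lia.
    by rewrite E; split; lia.
  apply: wp_skip; split=> //; sim; rewrite gC gL gR.
  have E : minn C i.+1 = minn C i by lia.
  by rewrite E; split; lia.
- by move=> t s1 fr [? _ []].
Qed.

Lemma wp_process x0 s p : mem s = m0 ->
  reg s rOne = 1 -> reg s rZero = 0 -> reg s rTab = TA -> reg s rLen = LA ->
  reg s rK = K -> reg s rW = W -> reg s rcard = #|X| -> reg s rcap = cp X ->
  reg s rp = p -> reg s rFree = free0 ->
  p + #|X| <= TA -> (forall j, j < #|X| -> m0 (p + j) = label (nth x0 (enum X) j)) ->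
  LA + #|S| <= free0 -> (forall a, free0 <= a -> m0 a = 0) ->
  wp process s (fun t s' => 
    [/\ t <= 250 * (#|X| * W) ^ 2, reg s' rp = p + #|X|, free0 <= reg s' rFree,
        (forall a, a < TA -> mem s' a = m0 a) /\
        (forall a, reg s' rFree <= a -> mem s' a = 0) &
        [/\ exists dom', components (X |: P) (mem s') (reg s' rFree) dom',
            reg s' rR = (minn (cp X) #|X|).+1 &
            table (X |: P) X ((minn (cp X) #|X|).+1 * W)
               (fun x => mem s' (reg s' racc + x))]]).
Proof.
move=> hm h1 h0 hTA hLA hK hW hcard hcap hp hfree pTA hlab lefree mz.
have X0 : 0 < #|X|.
  by case: lamF => nF _; rewrite card_gt0; apply: contraNneq nF => <-.
apply: wp_seq; apply: wp_block; sim; rewrite h0 hW hcard !addn0; set s1 := State _ _.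
apply: wp_seq; apply: wp_conseq (wp_mul_loop (s := s1) _ _) _ => //.
move=> t2 s2 fr2 [le2 LX2 y2].
have {le2 LX2} [le2 LX2] : t2 <= #|X| * 5 + 1 /\ reg s2 rLX = #|X|.+1 * W.
  by move: le2 LX2; rewrite /s1; sim; rewrite hW -mulSn.
apply: wp_seq; apply: wp_block; sim; frw fr2; rewrite /s1; sim.
rewrite h0 hcard hK hfree !addn0 LX2 hm; set s3 := State _ _.
apply: wp_seq; apply: wp_conseq (wp_labels (x0 := x0) (s := s3) (p := p)
  (LX := #|X|.+1 * W) _ _ _ _ _ _ _ _ pTA hlab lefree _) _ => //;
  rewrite ?/s3; sim; rewrite -/s3; frw fr2; rewrite /s1; sim => //.
  split; rewrite ?/s3 ?take0; sim; frw fr2; rewrite /s1; sim; rewrite ?addn0 //.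
    split=> a aP /=; rewrite /upd; case: eqP => // E; first by lia.
      by have : 0 < #|X|.+1 * W by [rewrite muln_gt0 W_gt0]; lia.
    by rewrite mz //; lia.
  rewrite /merged big_nil; apply: table_set0.
  - by rewrite muln_gt0 W_gt0.
  - by rewrite /upd addn0 eqxx.
  - by move=> x xP; rewrite /upd; case: eqP => [|_]; [lia | rewrite mz ?leq_addr].
move=> t4 s4 fr4 [le4 [p4 [acc4 free4] /(_ X0) [pt4 pl4] [m4 z4] tab4]].
apply: wp_seq; apply: wp_block; sim; frw fr4; rewrite /s3; sim; frw fr2; rewrite /s1; sim.
rewrite h0 hcard hW !addn0; set s5 := State _ _.
apply: wp_seq; apply: wp_conseq (wp_cap_loop (s := s5) (c := #|X|) (C := cp X)
  _ _ _ _ _ _ _) _ => //; rewrite ?/s5; sim; frw fr4; rewrite /s3; sim;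
  frw fr2; rewrite /s1; sim => //.
move=> t6 s6 fr6 [le6 L6 R6].
apply: wp_block; sim; rewrite R6 L6; frw fr6; sim; rewrite p4 pt4 pl4.
move: acc4 free4 m4 z4 tab4; rewrite take_oversize -?cardE // merged_enum.
move: (reg s4 racc) (reg s4 rFree) (mem s4) => acc free m acc4 free4 m4 z4 tab4.
clear s6 L6 R6 s5 fr6 fr4 p4 pt4 pl4 s4 s3 fr2 LX2 y2 s2 s1 h1 h0 hm hTA hLA hp hfree hK hW hcard hcap.
(* The last label of [X], where [rpt] and [rpl] point after the loop; it becomes the representative
   of the component [X]. *)
set e1 := nth x0 (enum X) #|X|.-1.
have e1X : e1 \in X by rewrite -mem_enum mem_nth // -cardE prednK.
set L := (minn (cp X) #|X|).+1 * W; set m' := upd _ _ L.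
have ll := label_lt e1.
have free0le : free0 <= free by lia.
have mTab e : m' (TA + label e) =
    if e == e1 then acc else if e \in X then 0 else m0 (TA + label e).
  have le := label_lt e.
  rewrite /m' /upd (_ : TA + label e == LA + label e1 = false); last by lia.
  rewrite eqn_add2l (inj_eq (@label_inj S)); case: eqP => // _.
  by rewrite m4 ?mem_tab_addr ?mem_enum //; lia.
have mLen e : m' (LA + label e) = if e == e1 then L else m0 (LA + label e).
  have le := label_lt e.
  rewrite /m' /upd eqn_add2l (inj_eq (@label_inj S)); case: eqP => // _.
  rewrite (_ : LA + label e == TA + label e1 = false); last by lia.
  by rewrite m4 ?notin_tab_addr //; lia.
have mHigh a : LA + #|S| <= a -> m' a = m a.
  move=> aP; rewrite /m' /upd (_ : a == LA + label e1 = false); last by lia.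
  by rewrite (_ : a == TA + label e1 = false) //; lia.
have mOld a : LA + #|S| <= a < free0 -> m' a = m0 a.
  by move=> /andP[aP aF]; rewrite mHigh // m4 // notin_tab_addr //; lia.
have Lle : L <= #|X|.+1 * W by rewrite leq_mul2r ltnS geq_minr orbT.
have tabX : table (X |: P) X L (fun x => m' (acc + x)).
  by apply: eq_table (table_cap FX tab4) => x xL; rewrite mHigh //; lia.
have al e : alive m' e = (e == e1) || (e \notin X) && alive0 e.
  have acc_gt0 : 0 < acc by lia.
  rewrite /alive mTab; case: (e =P e1) => [_|_] /=; first by rewrite -lt0n acc_gt0.
  by case: (e \in X).
pose dom' e := if e == e1 then X else dom e.
split=> //.
- clear -le2 le4 le6 X0 W_gt0.
  have : 0 < #|X| * W by rewrite muln_gt0 X0.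
  have : #|X| <= #|X| * W by rewrite leq_pmulr.
  by move: #|X| X0 le2 le4 le6 => c c0; rewrite !expnS expn0; nia.
- split=> a aP.
    rewrite /m' /upd; case: eqP => [|_]; first by lia.
    case: eqP => [|_]; first by lia.
    by rewrite m4 ?notin_tab_addr ?aP //; lia.
  by rewrite mHigh ?z4 //; lia.
split=> //; exists dom'; have [cA cT cC cU cS] := comps.
have domO e : e \notin X -> alive0 e -> [disjoint dom e & X] by move=> ? ?; apply: dom_out.
split.
- move=> e; rewrite al mTab mLen /dom'; case: eqP => [-> _|_ /= /andP[nX ae]].
    by split=> //; [right; rewrite !inE eqxx | split; lia].
  rewrite (negPf nX); have [? H [? ?] ?] := cA _ ae; split=> //; last by split=> //; lia.
  by case: H => [|H]; [left | right; rewrite inE H orbT].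
- move=> e; rewrite al mTab mLen /dom'; case: eqP => [-> _ //|_ /= /andP[nX ae]].
  rewrite (negPf nX); apply: table_other (domO _ nX ae) _.
  have [_ _ [? ?] _] := cA _ ae.
  by apply: eq_table (cT _ ae) => x xL; rewrite mOld //; lia.
- move=> z; have [zX|zX] := boolP (z \in X).
    by exists e1; rewrite ?al /dom' eqxx.
  have [e ae ze] := cC z.
  have eX : e \notin X.
    by apply: contra zX => eX; apply: (subsetP (dom_self ae eX)).
  exists e; first by rewrite al eX ae orbT.
  by rewrite /dom'; case: eqP => [E|//]; rewrite E e1X in eX.
- have key_e z e : z \in X -> alive m' e -> z \in dom' e -> e = e1.
    move=> zX; rewrite al /dom'; case: eqP => //= _ /andP[nX ae] ze.
    by have /pred0P/(_ z) := domO _ nX ae; rewrite /= ze zX.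
  move=> e e' z ae ae' ze ze'; have [zX|nzX] := boolP (z \in X).
    by rewrite (key_e z e) // (key_e z e').
  move: ae ae' ze ze'; rewrite !al /dom'.
  case: eqP => [_ _ _|_ /= /andP[_ ae]]; first by rewrite (negPf nzX).
  case: eqP => [_ _ _|_ /= /andP[_ ae']]; first by rewrite (negPf nzX).
  exact: cU.
- move=> Y; rewrite !inE => /orP[/eqP->|PY].
    by exists e1; rewrite ?al /dom' eqxx.
  have [e ae sY] := cS Y PY; have [eX|eX] := boolP (e \in X).
    exists e1; rewrite ?al /dom' eqxx //.
    exact: subset_trans sY (dom_self ae eX).
  exists e; first by rewrite al eX ae orbT.
  by rewrite /dom'; case: eqP => [E|//]; rewrite E e1X in eX.
Qed.

End Step.

End Process.

(** * Processing the family by increasing cardinality *)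

Section Scan.

Variables (S : finType) (F : {set {set S}}) (cp : {set S} -> nat) (Fs : seq {set S}).
Variables (W K : nat) (sp wt : S -> nat) (TA LA : nat) (mI : nat -> nat) (x0 : S).

(** The five leading words are numerator, denominator, [#|S|], size of the family and budget; then
    come two words per element, and per member two words before its labels. *)
Definition offset i := 5 + #|S|.*2 + \sum_(X <- take i Fs) (#|X| + 2).

Lemma offsetS i : i < size Fs -> offset i.+1 = offset i + 2 + #|nth set0 Fs i|.
Proof.
by move=> lt; rewrite /offset (take_nth set0) // big_rcons /= -addnA; lia.
Qed.

Hypothesis lamF : laminar F.
Hypothesis FT : [set: S] \in F.
Hypothesis permF : perm_eq Fs (enum F).
Hypothesis W_gt0 : 0 < W.
Hypothesis LAE : LA = TA + #|S|.
Hypothesis TAE : TA = offset (size Fs).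
Hypothesis layout : forall i, i < size Fs -> let X := nth set0 Fs i in
  [/\ mI (offset i) = cp X, mI (offset i + 1) = #|X| &
      forall j, j < #|X| -> mI (offset i + 2 + j) = label (nth x0 (enum X) j)].

Local Notation table := (table F cp W K sp wt).
Local Notation components := (components F cp W K sp wt TA LA).

Lemma Fs_uniq : uniq Fs.
Proof. by rewrite (perm_uniq permF) enum_uniq. Qed.

Lemma mem_Fs X : (X \in Fs) = (X \in F).
Proof. by rewrite (perm_mem permF) mem_enum. Qed.

Lemma offset_le i : i <= size Fs -> offset i <= TA.
Proof.
move=> le; rewrite TAE /offset leq_add2l take_size -{2}[Fs](cat_take_drop i).
by rewrite big_cat leq_addr.
Qed.

Definition processed z i : {set {set S}} :=
  [set X in F | (#|X| < z) || (#|X| == z) && (X \in take i Fs)].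

Lemma processed_skip z i : i < size Fs -> #|nth set0 Fs i| != z ->
  processed z i.+1 = processed z i.
Proof.
move=> lt ne; apply/setP => X; rewrite !inE (take_nth set0) // mem_rcons inE.
by case: (X =P _) => [->|//]; rewrite (negPf ne).
Qed.

Lemma processed_add z i : i < size Fs -> #|nth set0 Fs i| = z ->
  processed z i.+1 = nth set0 Fs i |: processed z i.
Proof.
move=> lt E; apply/setP => X; rewrite !inE (take_nth set0) // mem_rcons inE.
by case: (X =P _) => [->|//] /=; rewrite E eqxx ltnn -mem_Fs mem_nth.
Qed.

Lemma processed_next z : processed z (size Fs) = processed z.+1 0.
Proof.
apply/setP => X; rewrite !inE take_size take0 in_nil andbF orbF mem_Fs ltnS [#|X| <= z]leq_eqVlt.
by case: (X \in F) => //=; rewrite andbT orbC.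
Qed.

Lemma processed1 : processed 1 0 = set0.
Proof.
apply/setP => X; rewrite !inE take0 andbF orbF ltnS leqn0 cards_eq0.
by case: eqP => [->|_]; rewrite ?andbF // andbT; apply/negbTE; case: lamF.
Qed.

Lemma processed_all : processed #|S|.+1 0 = F.
Proof.
by apply/setP => X; rewrite !inE ltnS max_card andbT.
Qed.

Definition scan_inv (P : {set {set S}}) (s : state) : Prop :=
  [/\ forall a, a < TA -> mem s a = mI a,
      forall a, reg s rFree <= a -> mem s a = 0,
      LA + #|S| <= reg s rFree,
      exists dom, components P (mem s) (reg s rFree) dom &
      [set: S] \in P -> reg s rR = (minn (cp [set: S]) #|S|).+1 /\
        table P [set: S] (reg s rR * W) (fun x => mem s (reg s racc + x))].

Definition scan_regs (s : state) : Prop :=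
  [/\ [/\ reg s rOne = 1, reg s rZero = 0 & reg s rf = size Fs],
      reg s rTab = TA, reg s rLen = LA, reg s rK = K /\ reg s rW = W &
      reg s rSets = offset 0].

Definition set_time z i : nat :=
  20 + (if #|nth set0 Fs i| == z then 250 * (#|nth set0 Fs i| * W) ^ 2 else 0).

Lemma wp_set_body z i s : scan_regs s -> reg s rsz = z -> i < size Fs ->
  scan_inv (processed z i) s -> reg s rp = offset i ->
  wp set_body s (fun t s' => [/\ t <= set_time z i,
    scan_inv (processed z i.+1) s' & reg s' rp = offset i.+1]).
Proof.
move=> [[h1 h0 _] hTA hLA [hK hW] _] hz lt [mlo mhi lefree [dom comps] top] hp.
set X := nth set0 Fs i.
have [rd1 rd2 rd3] := layout lt.
have leTA : offset i + 2 + #|X| <= TA by rewrite -offsetS // offset_le.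
have XF : X \in F by rewrite -mem_Fs mem_nth.
apply: wp_seq; apply: wp_block; sim; rewrite hp h1 hz !mlo ?rd1 ?rd2 -?/X; try lia.
apply: wp_if; sim => nz.
  have ne : #|X| != z by apply/eqP; lia.
  apply: wp_block; sim; rewrite /set_time -/X (negPf ne) processed_skip //; split=> //.
    by split=> //; exists dom.
  by rewrite offsetS // -/X; lia.
have eqz : #|X| = z by lia.
have nP : X \notin processed z i.
  rewrite !inE eqz ltnn eqxx /= XF /=.
  have := Fs_uniq; rewrite -{1}[Fs](cat_take_drop i) (drop_nth set0) // -/X cat_uniq.
  by move=> /and3P[_ + _]; rewrite /= negb_or => /andP[].
have PF : processed z i \subset F by apply/subsetP => Y; rewrite inE => /andP[].
have Psm Y : Y \in processed z i -> #|Y| <= #|X|.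
  by rewrite inE eqz => /andP[_ /orP[/ltnW|/andP[/eqP->]]].
apply: wp_conseq (wp_process (x0 := x0) lamF W_gt0 LAE XF nP PF Psm comps (p := offset i + 2)
  _ _ _ _ _ _ _ _ _ _ _ _ _ _ _) _ => //; sim; rewrite ?rd1 ?rd2 //; try lia.
  by move=> j jX; rewrite mlo ?rd3 //; lia.
move=> t s' _ [le1 p1 free1 [lo1 hi1] [cm1 R1 tab1]]; split.
- by rewrite /set_time -/X eqz eqxx -eqz; move: (_ ^ 2) le1 => q; lia.
- rewrite processed_add // -/X; split=> //.
  + by move=> a aP; rewrite lo1 ?mlo.
  + by apply: leq_trans free1.
  (* [racc] and [rR] are overwritten by each processed member. They keep the table of the whole
     ground set because nothing is processed after it: a later member would be at least as large,
     hence equal to it. *)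
  rewrite in_setU1; have [E _|ne /= sP] := eqVneq [set: S] X; last first.
    case/negP: ne; rewrite eq_sym eqEcard subsetT /= cardsT.
    by have := Psm _ sP; rewrite cardsT.
  by move: R1 tab1; rewrite -E cardsT => ->.
- by rewrite p1 offsetS.
Qed.

Lemma scan_inv_eq P s s' : mem s' = mem s -> reg s' rFree = reg s rFree ->
  reg s' rR = reg s rR -> reg s' racc = reg s racc -> scan_inv P s -> scan_inv P s'.
Proof. by move=> hm hf hR ha; rewrite /scan_inv hm hf hR ha. Qed.

Lemma scan_regs_frame Q s s' : frame Q s s' -> scan_regs s ->
  all (fun i => i \notin wr Q) [:: 2; 3; rf; rTab; rLen; rK; rW; rSets] -> scan_regs s'.
Proof.
move=> fr [[h1 h0 hf] hTA hLA [hK hW] hS] /and5P[n1 n0 nf nTA /and5P[nLA nK nW nS _]].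
by rewrite /scan_regs !(frame_reg fr).
Qed.

Definition size_time z : nat := (\sum_(i < size Fs) (set_time z i + 3)) + 10.

Lemma wp_size_body z s : scan_regs s -> reg s rsz = z -> scan_inv (processed z 0) s ->
  wp size_body s (fun t s' => [/\ t <= size_time z,
    scan_inv (processed z.+1 0) s' & reg s' rsz = z.+1]).
Proof.
move=> rs hz I0; have [[h1 h0 hf] _ _ _ hS] := rs.
apply: wp_seq; apply: wp_block; sim; rewrite hS h0 hf !addn0; set s1 := State _ _.
have rs1 : scan_regs s1 by [].
have I1 : scan_inv (processed z 0) s1 by apply: scan_inv_eq I0.
apply: wp_seq; apply: wp_conseq (wp_rep (s := s1) (m := size Fs) (T := set_time z)
  (Inv := fun i s' => scan_inv (processed z i) s' /\ reg s' rp = offset i)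
  _ _ _ _ _) _ => //.
  move=> i s2 lt fr _ [I2 p2].
  have rs2 : scan_regs s2 by apply: scan_regs_frame fr rs1 _.
  have z2 : reg s2 rsz = z by frw fr.
  apply: wp_conseq (wp_set_body rs2 z2 lt I2 p2) _ => t s3 fr3 [le3 I3 p3].
  by split=> //; sim; split=> //; apply: scan_inv_eq I3.
move=> t s2 fr [le2 _ [I2 p2]]; apply: wp_block; sim; frw fr.
rewrite /s1; sim; rewrite h1 hz addn1; split=> //.
- by rewrite /size_time; move: (\sum_(_ < _) _) le2 => q; lia.
- by rewrite -processed_next; apply: scan_inv_eq I2.
Qed.

Variable N : nat.
Hypothesis leSN : #|S| <= N.
Hypothesis leFN : size Fs <= N.
Hypothesis leXN : \sum_(X <- Fs) #|X| <= N.

Lemma sum_sq_le (T : Type) (r : seq T) (f : T -> nat) :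
  \sum_(x <- r) f x ^ 2 <= (\sum_(x <- r) f x) ^ 2.
Proof.
elim: r => [|x r IH]; first by rewrite !big_nil.
rewrite !big_cons; apply: leq_trans (leq_add (leqnn _) IH) _.
by rewrite sqrnD leq_addr.
Qed.

(** After exchanging the sums, each member is processed in at most one pass, so its quadratic cost
    counts once, and a sum of squares is at most the square of the sum. The remaining term pays for
    skipping over the members. *)
Lemma size_time_total : \sum_(z < #|S|) (size_time z.+1 + 3) <= 300 * (N * W) ^ 2.
Proof.
pose c (X : {set S}) := 250 * (#|X| * W) ^ 2.
have sizeE z : size_time z + 3 = (size Fs * 23 + 13) +
    \sum_(i < size Fs) (if #|nth set0 Fs i| == z then c (nth set0 Fs i) else 0).
  rewrite /size_time /set_time.
  under eq_bigr => i _ do rewrite addnAC.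
  rewrite big_split /= sum_nat_const card_ord -/(c _).
  by move: (\sum_(_ < _) _) => q; lia.
under eq_bigr => z _ do rewrite sizeE.
rewrite big_split /= sum_nat_const card_ord exchange_big /=.
apply: leq_trans (_ : #|S| * (size Fs * 23 + 13) + 250 * (N * W) ^ 2 <= _).
  rewrite leq_add2l; apply: leq_trans (_ : \sum_(i < size Fs) c (nth set0 Fs i) <= _).
    apply: leq_sum => i _; rewrite -big_mkcond /=.
    have [z0|/prednK E] := posnP #|nth set0 Fs i|.
      by rewrite z0 big_pred0.
    have lt : #|nth set0 Fs i|.-1 < #|S| by rewrite E max_card.
    rewrite (big_pred1 (Ordinal lt)) // => z /=.
    by rewrite -[z == _]/(val z == _) /= -{1}E eqSS eq_sym.
  rewrite -(big_mkord xpredT (fun i => c (nth set0 Fs i))) -(big_nth set0 xpredT c).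
  rewrite -big_distrr /= leq_mul2l /=; apply: leq_trans (sum_sq_le _ _) _.
  by rewrite leq_sqr -big_distrl leq_mul2r leXN orbT.
have [N0|N0] := posnP N.
  by move: leSN; rewrite N0 leqn0 => /eqP->; rewrite !mul0n.
have : #|S| * (size Fs * 23 + 13) <= 36 * N ^ 2 by nia.
have : N ^ 2 <= (N * W) ^ 2 by rewrite leq_sqr leq_pmulr.
by move: (N ^ 2) ((N * W) ^ 2) => a b; lia.
Qed.

Lemma wp_sizes s : scan_regs s -> reg s rc = #|S| -> reg s rsz = 1 ->
  scan_inv set0 s ->
  wp (rep rc size_body) s (fun t s' =>
    t <= 300 * (N * W) ^ 2 + 1 /\ scan_inv F s').
Proof.
move=> rs hc hz I0; have [[h1 _ _] _ _ _ _] := rs.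
apply: wp_conseq (wp_rep (T := fun z => size_time z.+1)
  (Inv := fun j s' => scan_inv (processed j.+1 0) s' /\ reg s' rsz = j.+1) hc h1 _ _ _) _ => //.
- by rewrite processed1.
- move=> j s1 lt fr _ [I1 z1].
  have rs1 : scan_regs s1 by apply: scan_regs_frame fr rs _.
  apply: wp_conseq (wp_size_body rs1 z1 I1) _ => t s2 fr2 [le2 I2 z2].
  by split=> //; sim; split=> //; apply: scan_inv_eq I2.
- move=> t s1 fr [le1 _ [+ _]]; rewrite processed_all; split=> //.
  by apply: leq_trans le1 _; rewrite addn1 ltnS size_time_total.
Qed.

End Scan.

(** * Scaled profits and the initial singleton tables *)

Lemma wp_scale_loop s V Q G : reg s rOne = 1 -> reg s rd = V -> reg s rq = Q ->
  reg s rsp = 0 -> reg s rG = G -> 0 < G ->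
  wp (rep rd scale_body) s (fun t s' =>
    t <= V * 10 + 1 /\ reg s' rsp = minn V (Q %/ G)).
Proof.
move=> h1 hd hq hsp hG G0.
apply: wp_conseq (wp_repc (T := 7) (Inv := fun i s' =>
  reg s' rsp = minn i (Q %/ G) /\ reg s' rq = Q - minn i (Q %/ G) * G) hd h1 _ _ _) _ => //.
- by rewrite min0n mul0n subn0.
- move=> i s1 iV fr _ [gsp gq]; apply: wp_seq; apply: wp_block; sim; frw fr.
  rewrite h1 gq hG; have := divn_eq Q G; have := ltn_pmod Q G0.
  move: (Q %/ G) (Q %% G) gsp gq => d r gsp gq rG QE.
  apply: wp_if; sim => nz.
    have id : i < d by rewrite ltnNge; apply/negP => di; move: nz; rewrite (minn_idPr di); lia.
    apply: wp_block; sim; frw fr; rewrite gsp h1 hG gq.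
    have -> : minn i.+1 d = (minn i d).+1 by lia.
    by split=> //; split; lia.
  have di : d <= i.
    rewrite leqNgt; apply/negP => id; move: nz; rewrite (minn_idPl (ltnW id)).
    by have : i.+1 * G <= d * G by [rewrite leq_mul2r id orbT]; lia.
  apply: wp_skip; sim; rewrite gsp gq.
  by have -> : minn i.+1 d = minn i d by lia.
- by move=> t s1 _ [le1 _ [? _]]; split=> //; lia.
Qed.

Section Elements.

Variables (S : finType) (F : {set {set S}}) (cp : {set S} -> nat).
Variables (c p : S -> nat) (H G K TA LA : nat) (mI : nat -> nat).
Hypothesis LAE : LA = TA + #|S|.
Hypothesis G_gt0 : 0 < G.
Hypothesis costE : forall e, mI (5 + (label e).*2) = c e.
Hypothesis profitE : forall e, mI (6 + (label e).*2) = p e.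
Hypothesis TA_gt : 5 + #|S|.*2 <= TA.

Local Notation V := H.*2.
Local Notation W := V.+1.

(** The cap makes the key of a singleton smaller than [2 W]. Elements of profit below [2 G] are not
    affected by it. *)
Definition scaled (e : S) : nat := minn V (p e * H %/ G).
(** Within a set the low parts are distinct powers of two below [2 ^ #|S|] and never carry into the
    cost, so one addition both adds costs and unites disjoint sets. *)
Definition cost_mask (e : S) : nat := c e * 2 ^ #|S| + 2 ^ label e.

Lemma scaled_lt e : scaled e < W.
Proof. by rewrite ltnS geq_minl. Qed.

Definition element_regs (s : state) : Prop :=
  [/\ [/\ reg s rOne = 1, reg s rZero = 0 & reg s rn = #|S|],
      reg s rK = K, reg s rG = G, reg s rH = H & reg s rV = V /\ reg s rW = W].

Definition elements_inv free i (s : state) : Prop :=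
  [/\ [/\ reg s rp = 5 + i.*2, reg s rpt = TA + i, reg s rpl = LA + i & reg s rpw = 2 ^ i],
      reg s rFree = free + i * W.*2,
      forall a, a < TA -> mem s a = mI a,
      forall a, free + i * W.*2 <= a -> mem s a = 0 &
      forall e, label e < i ->
        [/\ mem s (TA + label e) = free + label e * W.*2, mem s (LA + label e) = W.*2,
            mem s (free + label e * W.*2) = K,
            mem s (free + label e * W.*2 + (W + scaled e)) = K - cost_mask e &
            forall x, 0 < x < W.*2 -> x != W + scaled e ->
              mem s (free + label e * W.*2 + x) = 0]].

Lemma wp_element_body free i s : LA + #|S| <= free -> i < #|S| ->
  element_regs s -> elements_inv free i s ->
  wp element_body s (fun t s' => t <= 5 * #|S| + 25 * W + 40 /\ elements_inv free i.+1 s').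
Proof.
move=> lefree iS [[h1 h0 hn] hK hG hH [hV hW]] [[gp gpt gpl gpw] gfree mlo mhi mtab].
pose e := enum_val (Ordinal iS); have le : label e = i by rewrite /label enum_valK.
have rd1 : mem s (5 + i.*2) = c e by rewrite mlo -?costE ?le //; lia.
have rd2 : mem s (5 + i.*2 + 1) = p e.
  by rewrite mlo -?profitE ?le; [congr mI; lia | lia].
apply: wp_seq; apply: wp_block; sim; rewrite gp h1 h0 hn rd1 rd2 addn0; set s1 := State _ _.
apply: wp_seq; apply: wp_conseq (wp_dbl_loop (s := s1) _ _) _ => //.
move=> t2 s2 fr2 [le2 x2 _]; move: le2 x2; rewrite /s1; sim => le2 x2.
apply: wp_seq; apply: wp_block; sim; frw fr2; rewrite /s1; sim.
rewrite gpw h0 hH addn0 x2; set s3 := State _ _.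
apply: wp_seq; apply: wp_conseq (wp_mul_loop (s := s3) _ _) _ => //.
  by rewrite /s3; sim; frw fr2.
move=> t4 s4 fr4 [le4 q4 _]; move: le4 q4; rewrite /s3; sim; frw fr2; rewrite /s1; sim.
rewrite add0n => le4 q4.
apply: wp_seq; apply: wp_block; sim; frw fr4; rewrite /s3; sim; frw fr2; rewrite /s1; sim.
rewrite h0 hV addn0; set s5 := State _ _.
apply: wp_seq; apply: wp_conseq (wp_scale_loop (s := s5) (V := V) (Q := H * p e) (G := G)
  _ _ _ _ _ _) _ => //; rewrite ?/s5; sim; frw fr4; rewrite /s3; sim; frw fr2;
  rewrite /s1; sim => //.
move=> t6 s6 fr6 [le6 sp6]; apply: wp_block; sim; rewrite sp6; frw fr6; sim; frw fr4.
rewrite /s3; sim; frw fr2; rewrite /s1; sim.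
rewrite h1 hK hW gpt gpl gfree.
have -> : minn V (H * p e %/ G) = scaled e by rewrite /scaled mulnC.
have -> : c e * 2 ^ #|S| + 2 ^ i = cost_mask e by rewrite /cost_mask le.
have sple := scaled_lt e.
split; first by lia.
have [p6 pw6] : reg s6 rp = 5 + i.*2 + 1 + 1 /\ reg s6 rpw = 2 ^ i + 2 ^ i.
  by frw fr6; sim; frw fr4; rewrite /s3; sim; frw fr2; rewrite /s1; sim.
clear -LAE lefree iS le mlo mhi mtab gfree TA_gt sple p6 pw6.
set b := free + i * W.*2; set m := upd _ _ (W + W).
have WW : W + W = W.*2 by rewrite addnn.
have mE a : m a = if a == LA + i then W.*2 else if a == TA + i then b else
    if a == b + (W + scaled e) then K - cost_mask e else if a == b then K else mem s a.
  by rewrite /m /upd addnA WW.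
split; sim.
- by rewrite p6 pw6; split; rewrite ?expnS; lia.
- by rewrite WW /b; lia.
- by move=> a aP; rewrite !mE; do 4?[case: eqP => [?|_]; first by lia]; apply: mlo.
- move=> a aP; rewrite mulSn in aP; rewrite mE.
  do 4?[case: eqP => [?|_]; first by lia]; apply: mhi; lia.
- move=> e' le'; have [E|ne] := eqVneq e' e.
    rewrite E le -/b; split.
    + by rewrite mE eqxx; case: eqP => // ?; lia.
    + by rewrite mE eqxx.
    + rewrite mE; do 3?[case: eqP => [?|_]; first by lia].
      by rewrite eqxx.
    + rewrite mE; do 2?[case: eqP => [?|_]; first by lia].
      by rewrite eqxx.
    + move=> x xP xne; rewrite mE; do 2?[case: eqP => [?|_]; first by lia].
      rewrite eqn_add2l (negPf xne); case: eqP => [?|_]; first by lia.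
      by apply: mhi; rewrite leq_addr.
  have lt : label e' < i.
    rewrite ltn_neqAle -ltnS le' andbT; apply: contra ne => /eqP.
    by rewrite -le => /label_inj ->.
  have lo : free + label e' * W.*2 + W.*2 <= b.
    by rewrite /b -addnA leq_add2l addnC -mulSn leq_mul2r lt orbT.
  have lb : LA + i < free + label e' * W.*2 by lia.
  have [m1 m2 m3 m4 m5] := mtab e' lt.
  split.
  + by rewrite mE; do 4?[case: eqP => [?|_]; first by lia].
  + by rewrite mE; do 4?[case: eqP => [?|_]; first by lia].
  + by rewrite mE; do 4?[case: eqP => [?|_]; first by lia].
  + have := scaled_lt e'.
    by rewrite mE; do 4?[case: eqP => [?|_]; first by lia].
  + move=> x xP xne.
    by rewrite mE; do 4?[case: eqP => [?|_]; first by lia]; apply: m5.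
Qed.

Lemma wp_elements free s : LA + #|S| <= free -> element_regs s -> reg s rc = #|S| ->
  elements_inv free 0 s ->
  wp (rep rc element_body) s (fun t s' => t <= #|S| * (5 * #|S| + 25 * W + 43) + 1 /\
    scan_inv F cp W K scaled cost_mask TA LA mI set0 s').
Proof.
move=> lefree rs hc I0; have [[h1 h0 hn] hK hG hH [hV hW]] := rs.
apply: wp_conseq (wp_repc (T := 5 * #|S| + 25 * W + 40) (Inv := elements_inv free)
  hc h1 _ I0 _) _ => //.
  move=> i s1 iS fr _ I1.
  have rs1 : element_regs s1 by rewrite /element_regs; frw fr.
  apply: wp_conseq (wp_element_body lefree iS rs1 I1) _ => t s2 fr2 [le2 I2].
  by split=> //; case: I2.
move=> t s1 fr [le1 _ [_ gfree mlo mhi mtab]]; split; first by rewrite -[43]/(40 + 3) addnA.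
have {}mtab e := mtab e (label_lt e).
have al (e : S) : alive TA (mem s1) e.
  have [m1 _ _ _ _] := mtab e; rewrite /alive m1; have := label_lt e; lia.
split=> //.
- by rewrite gfree.
- by rewrite gfree; lia.
- exists (fun e => [set e]); split.
  + move=> e _; have [m1 m2 _ _ _] := mtab e; rewrite m1 m2 inE eqxx cards1; split=> //.
    * by left.
    * split; first lia.
      by rewrite gfree -addnA leq_add2l addnC -mulSn leq_mul2r label_lt orbT.
    * lia.
  + move=> e _; have [m1 m2 m3 m4 m5] := mtab e; rewrite m1 m2.
    apply: table_set1 => //; first exact: scaled_lt.
    by rewrite addn0.
  + by move=> z; exists z; rewrite ?inE.
  + by move=> e e' z _ _; rewrite !inE => /eqP-> /eqP.
  + by move=> Y; rewrite inE.
- by rewrite inE.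
Qed.

End Elements.

(** * Searching the final table *)

Lemma wp_row_loop s R W a b : reg s rOne = 1 -> reg s rZero = 0 -> reg s rd = R ->
  reg s rW = W -> reg s ry = a -> reg s rBest = b ->
  wp (rep rd row_body) s (fun t s' => t <= R * 11 + 1 /\
    ((reg s' rBest = b /\ forall i, i < R -> mem s (a + i * W) = 0) \/
     (exists i, [/\ i < R, reg s' rBest = mem s (a + i * W) & reg s' rBest != 0]))).
Proof.
move=> h1 h0 hd hW hy hb.
apply: wp_conseq (wp_repc (T := 8) (Inv := fun j s' => reg s' ry = a + j * W /\
    ((reg s' rBest = b /\ forall i, i < j -> mem s (a + i * W) = 0) \/
     (exists i, [/\ i < j, reg s' rBest = mem s (a + i * W) & reg s' rBest != 0])))
  hd h1 _ _ _) _ => //.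
- by split; [rewrite addn0 | left].
- move=> j s1 jR fr _ [gy gb]; apply: wp_seq; apply: wp_block; sim.
  apply: wp_seq; apply: wp_if; sim; frw fr; rewrite gy => nz.
    apply: wp_block; sim; apply: wp_block; sim; frw fr; rewrite h0 hW addn0.
    split=> //; split; first lia.
    by right; exists j.
  apply: wp_skip; apply: wp_block; sim; frw fr; rewrite hW.
  split=> //; split; first lia.
  case: gb => [[gb z]|[i [ij gb nb]]]; [left; split=> // i | by right; exists i; split=> //; apply: ltnW].
  by rewrite ltnS leq_eqVlt => /orP[/eqP->|/z].
- by move=> t s1 _ [? _ [_ ?]].
Qed.

Lemma wp_columns s R W Th acc b : reg s rOne = 1 -> reg s rZero = 0 -> reg s rR = R ->
  reg s rW = W -> reg s rx = acc + Th -> reg s rc = W - Th -> reg s rBest = b -> Th <= W ->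
  wp (rep rc column_body) s (fun t s' => t <= W * (R * 11 + 11) + 1 /\
    ((reg s' rBest = b /\
      forall v i, Th <= v < W -> i < R -> mem s (acc + (i * W + v)) = 0) \/
     (exists v i, [/\ Th <= v < W /\ i < R, reg s' rBest = mem s (acc + (i * W + v)),
        reg s' rBest != 0 & forall v' i', Th <= v' < W -> i' < R ->
          mem s (acc + (i' * W + v')) != 0 -> v' <= v]))).
Proof.
move=> h1 h0 hR hW hx hc hb leTh.
apply: wp_conseq (wp_repc (T := R * 11 + 8) (Inv := fun j s' => reg s' rx = acc + Th + j /\
    ((reg s' rBest = b /\
      forall v i, Th <= v < Th + j -> i < R -> mem s (acc + (i * W + v)) = 0) \/
     (exists v i, [/\ Th <= v < Th + j /\ i < R, reg s' rBest = mem s (acc + (i * W + v)),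
        reg s' rBest != 0 & forall v' i', Th <= v' < Th + j -> i' < R ->
          mem s (acc + (i' * W + v')) != 0 -> v' <= v])))
  hc h1 _ _ _) _ => //.
- by split; [rewrite addn0 | left; split=> // v i; lia].
- move=> j s1 jW fr _ [gx gb]; apply: wp_seq; apply: wp_block; sim; frw fr.
  rewrite gx h0 hR !addn0; set s2 := State _ _.
  apply: wp_seq; apply: wp_conseq (wp_row_loop (s := s2) (R := R) (W := W)
    (a := acc + Th + j) (b := reg s1 rBest) _ _ _ _ _ _) _ => //; rewrite ?/s2; sim;
    frw fr; rewrite //.
  move=> t s3 fr3 [le3 best3]; apply: wp_block; sim; frw fr3; rewrite /s2; sim; frw fr.
  rewrite h1 gx; split; first lia.
  split; first lia.
  have E i : acc + Th + j + i * W = acc + (i * W + (Th + j)) by lia.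
  case: best3 => [[-> z3]|[i [iR bE nb]]]; last first.
    right; exists (Th + j), i; rewrite -E; split=> //; first by split=> //; lia.
    by move=> v' i' ? _ _; lia.
  case: gb => [[gb z]|[v [i [vP gb nb mx]]]]; [left | right].
    split=> // v i vP iR; have [->|ne] := eqVneq v (Th + j); first by rewrite -E z3.
    by apply: z => //; lia.
  exists v, i; split=> //; first by lia.
  move=> v' i' vP' iR' nz; have [Ev|ne] := eqVneq v' (Th + j).
    by move: nz; rewrite Ev -E z3.
  by apply: mx nz => //; lia.
- move=> t s1 _ [le1 _ [_]]; rewrite subnKC // => H; split=> //.
  apply: leq_trans le1 _; rewrite leq_add2r -addnA leq_mul //; lia.
Qed.

(** * Masks, the budget, and the guarantee of one guess *)

Lemma sum_pow2 m : \sum_(i < m) 2 ^ i < 2 ^ m.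
Proof.
elim: m => [|m IH]; first by rewrite big_ord0.
by rewrite big_ord_recr /= expnS mul2n -addnn ltn_add2r.
Qed.

Definition mask (S : finType) (A : {set S}) : nat := \sum_(e in A) 2 ^ label e.

Lemma mask_lt (S : finType) (A : {set S}) : mask A < 2 ^ #|S|.
Proof.
apply: leq_ltn_trans (sum_pow2 _).
rewrite (reindex (@enum_rank S)) /=; last by apply: onW_bij; apply: enum_rank_bij.
by rewrite [X in _ <= X](bigID (fun e => e \in A)) /= leq_addr.
Qed.

Lemma weight_cost_mask (S : finType) (c : S -> nat) (A : {set S}) :
  weight (cost_mask c) A = (\sum_(e in A) c e) * 2 ^ #|S| + mask A.
Proof. by rewrite /weight big_split big_distrl. Qed.

Section Guess.

Variables (I : blm) (k : nat).
Let S := ground I.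
Hypothesis k_gt0 : 0 < k.

Local Notation n := #|ground I|.
Local Notation H := (n * k).
Local Notation V := H.*2.
Local Notation W := V.+1.
Local Notation K := ((budget I).+1 * 2 ^ n).
Local Notation wt := (cost_mask (@cost I)).
Local Notation sp := (scaled (@profit I) H).
Local Notation table G := (table (fam I) (@cap I) W K (sp G) wt).

Lemma ground_gt0 : 0 < n.
Proof.
rewrite lt0n; apply/negP => /eqP n0; case: (fam_laminar I) => + _.
suff -> : set0 = [set: ground I] by rewrite fam_ground.
by apply/eqP; rewrite eq_sym -cards_eq0 cardsT n0.
Qed.

(** The mask is below [2 ^ n], so it cannot push a cost within budget up to the next multiple of
    [2 ^ n]. *)
Lemma weight_lt_budget (A : {set S}) : (weight wt A < K) = (total_cost A <= budget I).
Proof.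
rewrite weight_cost_mask -/(total_cost A); have := mask_lt A.
have : 0 < 2 ^ n by rewrite expn_gt0.
move: (2 ^ n) (mask A) (total_cost A) (budget I) => M m x B M0 mM.
apply/idP/idP => [lt|le]; last by nia.
rewrite leqNgt; apply/negP => gt; have : B.+1 * M <= x * M by rewrite leq_mul2r gt orbT.
by lia.
Qed.

(** Invariant over the guesses: the ratio [1 - 1/k] is promised only once the guess has passed
    [OPT]. Until then it is only known that a solution is stored. *)
Definition best_ok G b : Prop :=
  exists A : {set S}, [/\ solution A, b = K - weight wt A, b != 0 &
    OPT I < G -> k.-1 * OPT I <= k * total_profit A].

Lemma opt_attained : exists2 A : {set S}, solution A & total_profit A = OPT I.
Proof.
have s0 : solution (set0 : {set S}).
  rewrite /solution /total_cost big_set0 andbT.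
  by apply/forall_inP => X _; rewrite set0I cards0.
have := eq_bigmax_cond (fun A : {set S} => total_profit A) (A := fun A => solution A).
case=> [|A sA E]; first by apply/card_gt0P; exists set0.
by exists A.
Qed.

Lemma best_ok1 : best_ok 1 K.
Proof.
exists set0; rewrite /weight big_set0 subn0; split=> //.
- rewrite /solution /total_cost big_set0 andbT.
  by apply/forall_inP => X _; rewrite set0I cards0.
- by rewrite muln_eq0 expn_eq0.
- by rewrite ltnS leqn0 => /eqP->; rewrite muln0.
Qed.

Lemma scaled_profit_le G (A : {set S}) :
  (\sum_(e in A) sp G e) * G <= H * total_profit A.
Proof.
rewrite /total_profit big_distrl big_distrr /=; apply: leq_sum => e _.
rewrite [H * _]mulnC; apply: leq_trans (leq_trunc_div _ G).
by rewrite leq_mul2r geq_minr orbT.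
Qed.

(** Every element of [A] has profit below [2 G] and escapes the cap, so each loses less than one
    unit, worth [G], by rounding down. *)
Lemma scaled_profit_ge G (A : {set S}) : 0 < G -> total_profit A < G.*2 ->
  H * total_profit A <= (\sum_(e in A) sp G e) * G + n * G.
Proof.
move=> G0 lt; apply: leq_trans (_ : \sum_(e in A) (sp G e * G + G) <= _); last first.
  rewrite big_split /= sum_nat_const big_distrl /= leq_add2l leq_mul2r.
  by rewrite max_card orbT.
rewrite /total_profit big_distrr /=; apply: leq_sum => e eA.
have pe : profit e < G.*2.
  by apply: leq_ltn_trans lt; rewrite /total_profit (bigD1 e) //= leq_addr.
have H0 : 0 < H by rewrite muln_gt0 ground_gt0.
have le : profit e * H %/ G <= V.
  rewrite -ltnS ltnS; apply: ltnW; rewrite ltn_divLR //; nia.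
rewrite /scaled (minn_idPr le) mulnC addnC -mulSn ltnW // ltn_ceil //.
Qed.

Lemma guess_step G b b' f R : 0 < G -> R = (minn (@cap I [set: ground I]) n).+1 ->
  table G (fam I) [set: S] (R * W) f -> best_ok G b ->
  (b' = b /\ forall v i, n * k.-1 <= v < W -> i < R -> f (i * W + v) = 0) \/
  (exists v i, [/\ n * k.-1 <= v < W /\ i < R, b' = f (i * W + v), b' != 0 &
     forall v' i', n * k.-1 <= v' < W -> i' < R -> f (i' * W + v') != 0 -> v' <= v]) ->
  best_ok (G + G) b'.
Proof.
move=> G0 RE [so co] bok found.
have n0 := ground_gt0.
have HE : H = n * k.-1 + n by rewrite -mulnSr prednK.
(* For the right guess the optimal set has scaled profit at most [H * OPT / G], less than [2 H], so
   it is a target and its cell is nonzero. Rounding costs at most [n] of the at least [H = n k]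
   units, so its column reaches the threshold [n * k.-1]. *)
have star : G <= OPT I -> OPT I < G + G -> exists v i,
    [/\ n * k.-1 <= v < W, i < R, f (i * W + v) != 0 & H * OPT I <= v * G + n * G].
  move=> leG ltG; have [A sA pA] := opt_attained.
  have [iA cA] := andP sA.
  have spV : \sum_(e in A) sp G e < W.
    rewrite ltnS -(leq_pmul2r G0); apply: leq_trans (scaled_profit_le _ _) _.
    by rewrite pA; nia.
  have tA : target (fam I) (@cap I) W (sp G) A by split=> // Y /(forall_inP iA).
  have := co A tA; rewrite setIT keyE => -[kL kf].
  have lo : H * OPT I <= (\sum_(e in A) sp G e) * G + n * G.
    by rewrite -pA; apply: scaled_profit_ge => //; rewrite pA -addnn.
  exists (\sum_(e in A) sp G e), #|A|; split=> //.
  - rewrite spV andbT -(leq_pmul2r G0) -(leq_add2r (n * G)).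
    apply: leq_trans lo; rewrite -mulnDl -HE leq_mul2l leG orbT //.
  - by rewrite -(ltn_pmul2r (ltn0Sn V)); apply: leq_ltn_trans kL; rewrite leq_addr.
  - rewrite -lt0n; apply: leq_trans kf; rewrite subn_gt0.
    by rewrite weight_lt_budget.
case: found => [[-> z]|[v [i [[vP iR] bE nb mx]]]].
  case: bok => A [sA bA nbA okA]; exists A; split=> // ltG; apply: okA.
  rewrite ltnNge; apply/negP => leG; have [v [i [vP iR nz _]]] := star leG ltG.
  by move: nz; rewrite z.
have xL : i * W + v < R * W.
  have : i.+1 * W <= R * W by rewrite leq_mul2r iR orbT.
  by rewrite mulSn; lia.
rewrite bE in nb; have [A [_ kA fA feA]] := so _ xL nb.
have cA : #|A| <= i by apply: (key_card (W := W) (sp := sp G)); rewrite kA mulSn; lia.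
(* A set in row [i] with fewer than [i] elements makes up for them by scaled profit, so the column
   can only underestimate it. *)
have vle : v <= \sum_(e in A) sp G e.
  move: kA; rewrite keyE; have : #|A| * W <= i * W by rewrite leq_mul2r cA orbT.
  by lia.
have ple := scaled_profit_le G A.
have vG : v * G <= H * total_profit A.
  by apply: leq_trans ple; rewrite leq_mul2r vle orbT.
have suf : n * (k.-1 * OPT I) <= H * total_profit A -> k.-1 * OPT I <= k * total_profit A.
  by rewrite -mulnA leq_pmul2l.
exists A; rewrite bE; split=> //.
- apply/andP; split; first by apply/forall_inP => Y /feA.
  by rewrite -weight_lt_budget ltnNge -subn_eq0 -fA.
(* If [OPT] is below [G], the threshold on the column alone is enough. Otherwise the guess is right,
   and the chosen column is at least that of the optimal set. *)
move=> ltG; apply: suf; have [lt|ge] := ltnP (OPT I) G.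
  apply: leq_trans vG; rewrite mulnA; apply: leq_mul; [by case/andP: vP | exact: ltnW].
have [v' [i' [vP' iR' nz lo]]] := star ge ltG.
have vv := mx _ _ vP' iR' nz.
have : v' * G <= v * G by rewrite leq_mul2r vv orbT.
have : n * G <= n * OPT I by rewrite leq_mul2l ge orbT.
by move: lo; rewrite HE mulnDl -mulnA; lia.
Qed.

End Guess.

(** * Addresses in the encoded input *)

Lemma nth_flatten_map (T : Type) (x0 : T) (g : T -> seq nat) (l : seq T) i j :
  i < size l -> j < size (g (nth x0 l i)) ->
  nth 0 (flatten [seq g x | x <- l]) (\sum_(x <- take i l) size (g x) + j) =
  nth 0 (g (nth x0 l i)) j.
Proof.
elim: l i => [//|x l IH] [|i] /= il jl; first by rewrite big_nil add0n nth_cat jl.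
rewrite big_cons nth_cat ifN; last by lia.
by rewrite -addnA addKn IH.
Qed.

Section Layout.

Variables (I : blm) (Fs : seq {set ground I}) (a b : nat) (x0 : ground I).

Local Notation n := #|ground I|.
Local Notation mI := (nth 0 [:: a, b & encode Fs]).

Definition encode_element (e : ground I) : seq nat := [:: @cost I e; @profit I e].

Lemma size_elements :
  size (flatten [seq [:: @cost I e; @profit I e] | e <- enum (ground I)]) = n.*2.
Proof.
rewrite size_flatten /shape -map_comp sumnE big_map /= big_const_seq count_predT -cardE.
by rewrite iter_addn_0 mul2n.
Qed.

Lemma encode_cost e : mI (5 + (label e).*2) = @cost I e.
Proof.
have lt : label e < size (enum (ground I)) by rewrite -cardE label_lt.
rewrite /= nth_cat size_elements.
rewrite ltn_double label_lt.
have := nth_flatten_map (x0 := x0) (j := 0) (g := encode_element) lt.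
rewrite (eq_bigr (fun=> 2)) // big_const_seq count_predT size_take lt iter_addn_0 mul2n addn0 => -> //=.
by rewrite nth_enum_rank.
Qed.

Lemma encode_profit e : mI (6 + (label e).*2) = @profit I e.
Proof.
have lt : label e < size (enum (ground I)) by rewrite -cardE label_lt.
rewrite /= nth_cat size_elements.
have -> : (label e).*2.+1 < n.*2 by have := label_lt e; lia.
have := nth_flatten_map (x0 := x0) (j := 1) (g := encode_element) lt.
rewrite (eq_bigr (fun=> 2)) // big_const_seq count_predT size_take lt iter_addn_0 mul2n addn1 => -> //=.
by rewrite nth_enum_rank.
Qed.

Definition encode_set (X : {set ground I}) : seq nat :=
  [:: cap X, #|X| & [seq label e | e <- enum X]].

Lemma size_encode_set X : size (encode_set X) = #|X| + 2.
Proof. by rewrite /= size_map -cardE addn2. Qed.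

Lemma encode_sets i j : i < size Fs -> j < #|nth set0 Fs i| + 2 ->
  mI (offset Fs i + j) = nth 0 (encode_set (nth set0 Fs i)) j.
Proof.
move=> lt jX; rewrite -(nth_flatten_map (x0 := set0)) ?size_encode_set //.
rewrite /offset -!addnA /= nth_cat size_elements ifN -?leqNgt ?leq_addr // add0n addKn.
by congr (nth 0 _ (_ + _)); apply: eq_bigr => X _; rewrite size_map -cardE addn2.
Qed.

Lemma encode_layout i : i < size Fs -> let X := nth set0 Fs i in
  [/\ mI (offset Fs i) = cap X, mI (offset Fs i + 1) = #|X| &
      forall j, j < #|X| -> mI (offset Fs i + 2 + j) = label (nth x0 (enum X) j)].
Proof.
move=> lt X; split=> [||j jX].
- by rewrite -[offset Fs i]addn0 encode_sets // addn2.
- by rewrite encode_sets // addn2.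
- rewrite -addnA encode_sets //; last by rewrite addnC ltn_add2r.
  by rewrite /= (nth_map x0) // -cardE.
Qed.

Lemma size_input : size [:: a, b & encode Fs] = offset Fs (size Fs).
Proof.
rewrite /offset take_size /= !size_cat size_elements size_flatten /shape -map_comp.
rewrite sumnE big_map [X in 5 + _ + X](eq_bigr (fun X => size (encode_set X))).
  by [].
by move=> X _; rewrite size_encode_set.
Qed.

End Layout.

(** * The loop over the guesses *)

(** The number of doublings that take 1 beyond [x], hence an exact iteration count; unlike
    [bit_length] it is 0 at 0, where the loops do not run. *)
Definition nbits (x : nat) : nat := if x == 0 then 0 else (trunc_log 2 x).+1.

Lemma nbits_le i x : i < nbits x -> 2 ^ i <= x.
Proof.
rewrite /nbits; case: eqP => // /eqP; rewrite -lt0n ltnS => x0 le.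
by apply: leq_trans (trunc_logP (isT : 1 < 2) x0); rewrite leq_exp2l.
Qed.

Lemma nbits_gt x : x < 2 ^ nbits x.
Proof. by rewrite /nbits; case: eqP => [->//|_]; apply: trunc_log_ltn. Qed.

Lemma nbits_leq x L : x < 2 ^ L -> nbits x <= L.
Proof.
move=> lt; rewrite leqNgt; apply/negP => /nbits_le le.
by move: lt; rewrite ltnNge le.
Qed.

Section Run.

Variables (I : blm) (Fs : seq {set ground I}) (a b k N : nat) (x0 : ground I).
Hypothesis permF : perm_eq Fs (enum (fam I)).
Hypothesis k_gt0 : 0 < k.

Local Notation n := #|ground I|.
Local Notation mI := (nth 0 [:: a, b & encode Fs]).
Local Notation H := (n * k).
Local Notation W := (H.*2.+1).
Local Notation K := ((budget I).+1 * 2 ^ n).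
Local Notation TA := (offset Fs (size Fs)).
Local Notation LA := (TA + n).
Local Notation profits := (total_profit [set: ground I]).

Hypothesis le_nN : n <= N.
Hypothesis le_FN : size Fs <= N.
Hypothesis le_XN : \sum_(X <- Fs) #|X| <= N.

Definition static (s : state) : Prop :=
  [/\ scan_regs Fs W K TA LA s,
      [/\ reg s rn = n, reg s rH = H & reg s rV = H.*2],
      reg s rTh = n * k.-1 & reg s rSum = profits.+1].

(** Tables of earlier guesses stay below [rFree] as garbage; a new guess rewrites the directory and
    builds its tables on zeroed memory. *)
Definition guess_inv G (s : state) : Prop :=
  [/\ reg s rG = G /\ reg s rD = profits.+1 - G,
      forall x, x < TA -> mem s x = mI x,
      forall x, reg s rFree <= x -> mem s x = 0,
      LA + n <= reg s rFree &
      best_ok I k G (reg s rBest)].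

Lemma wp_guess_body G s : 0 < G -> static s -> guess_inv G s ->
  wp guess_body s (fun t s' => t <= 450 * (N * W) ^ 2 /\ guess_inv (G + G) s').
Proof.
move=> G0 [rs [hn hH hV] hTh hSum] [[hG _] mlo mhi lefree bok].
have [[h1 h0 hf] hTA hLA [hK hW] hS] := rs.
have W0 : 0 < W by [].
have n0 : 0 < n by apply: ground_gt0.
have TA5 : 5 + n.*2 <= TA by rewrite /offset leq_addr.
apply: wp_seq; apply: wp_block; sim; rewrite hn h0 hTA hLA !addn0; set s1 := State _ _.
have er1 : element_regs (ground I) H G K s1.
  by rewrite /element_regs /s1; sim.
have I1 : elements_inv (@cost I) (@profit I) H G K TA LA mI (reg s rFree) 0 s1.
  by split; rewrite ?addn0 ?mul0n ?addn0 //; rewrite /s1; sim; rewrite ?addn0.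
apply: wp_seq; apply: wp_conseq (wp_elements (fam I) (@cap I) erefl G0
  (encode_cost Fs a b x0) (encode_profit Fs a b x0) TA5 lefree er1 erefl I1) _ => //.
move=> t2 s2 fr2 [le2 I2].
have rs2 : scan_regs Fs W K TA LA s2 by apply: scan_regs_frame fr2 _ _.
apply: wp_seq; apply: wp_block; sim; frw fr2; rewrite /s1; sim; rewrite hn h0 addn0.
set s3 := State _ _.
have rs3 : scan_regs Fs W K TA LA s3 by [].
have I3 : scan_inv (fam I) (@cap I) W K (scaled (@profit I) H G) (cost_mask (@cost I)) TA LA mI set0 s3.
  by apply: scan_inv_eq I2.
apply: wp_seq; apply: wp_conseq (wp_sizes (fam_laminar I) (fam_ground I) permF W0 erefl erefl
  (encode_layout a b x0) le_nN le_FN le_XN rs3 erefl erefl I3) _.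
move=> t4 s4 fr4 [le4 [mlo4 mhi4 free4 _ /(_ (fam_ground I)) [R4 tab4]]].
apply: wp_seq; apply: wp_block; sim; frw fr4; rewrite /s3; sim; frw fr2; rewrite /s1; sim.
rewrite hTh hW; set s5 := State _ _.
have leTh : n * k.-1 <= W.
  by have : n * k.-1 <= H by [rewrite leq_mul2l leq_pred orbT]; lia.
have bestE : reg s4 rBest = reg s rBest.
  by frw fr4; rewrite /s3; sim; frw fr2.
apply: wp_seq; apply: wp_conseq (wp_columns (s := s5) (R := reg s4 rR) (W := W)
  (Th := n * k.-1) (acc := reg s4 racc) (b := reg s rBest) _ _ _ _ _ _ _ leTh) _ => //;
  rewrite ?/s5; sim; frw fr4; rewrite /s3; sim; frw fr2; rewrite /s1; sim => //.
move=> t6 s6 fr6 [le6 found]; apply: wp_block; sim; frw fr6; sim; frw fr4.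
rewrite /s3; sim; frw fr2; rewrite /s1; sim; rewrite hG hSum.
split; last first.
  split=> //; sim; frw fr6; rewrite ?/s5; sim=> //.
  by apply: guess_step R4 tab4 bok found.
have Rle : reg s4 rR <= n.+1 by rewrite R4 ltnS geq_minr.
have nW : n * W <= N * W by rewrite leq_mul2r le_nN orbT.
have WN : W <= N * W by rewrite leq_pmull // (leq_trans n0).
have sq : N * W <= (N * W) ^ 2 by rewrite expnS expn1 leq_pmull // muln_gt0 (leq_trans n0).
(* Each summand is bounded separately by [(N * W) ^ 2]: [73 = 5 + 25 + 43] here and [33 = 11 + 22]
   in [e2]. With 300 for the scan this leaves room below 450 for the linear terms. *)
have e1 : n * (5 * n + 25 * W + 43) <= 73 * (N * W) ^ 2.
  have : n * n <= (N * W) ^ 2.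
    by rewrite expnS expn1 leq_mul // (leq_trans le_nN) // leq_pmulr.
  have : n <= n * W by rewrite leq_pmulr.
  by clear -nW sq; move: (n * W) (N * W) ((N * W) ^ 2) W nW sq => x y z w; lia.
have e2 : W * (reg s4 rR * 11 + 11) <= 33 * (N * W) ^ 2.
  apply: leq_trans (_ : W * (n * 11 + 22) <= _); first by rewrite leq_mul2l; lia.
  by clear -nW sq WN; move: (N * W) ((N * W) ^ 2) nW sq WN => y z; lia.
by move: ((N * W) ^ 2) le2 le4 le6 e1 e2 sq WN => q; clear; lia.
Qed.

Lemma wp_guesses s : static s -> guess_inv 1 s ->
  wp (While rD guess_body) s (fun t s' =>
    t <= nbits profits * (450 * (N * W) ^ 2 + 1) + 1 /\
    exists A : {set ground I}, [/\ solution A, reg s' rBest = K - weight (cost_mask (@cost I)) A,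
      reg s' rBest != 0 & k.-1 * OPT I <= k * total_profit A]).
Proof.
move=> st I0.
apply: wp_conseq (wp_while (m := nbits profits) (T := fun=> 450 * (N * W) ^ 2)
  (Inv := fun i s' => guess_inv (2 ^ i) s') I0 _ _) _.
- move=> s1 fr [[_ ->] _ _ _ _]; have := nbits_gt profits; lia.
- move=> i s1 lt fr I1; split.
    by have [[_ ->] _ _ _ _] := I1; have := nbits_le lt; lia.
  have st1 : static s1.
    have [rs [hn hH hV] hTh hSum] := st; split; frw fr => //.
    by apply: scan_regs_frame fr rs _.
  apply: wp_conseq (wp_guess_body _ st1 I1) _; first by rewrite expn_gt0.
  by move=> t s2 _ [? I2]; split=> //; rewrite expnS mul2n -addnn.
- move=> t s1 _ [le1 [_ _ _ _ [A [sA bE nb ok]]]]; split.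
    by move: le1; rewrite sum_nat_const card_ord !addn1.
  (* The last guess exceeds the total profit and therefore [OPT], so the promise in [best_ok]
     applies. *)
  exists A; split=> //; apply: ok; apply: leq_ltn_trans (nbits_gt _).
  have [T sT <-] := opt_attained I; rewrite /total_profit [X in _ <= X](bigID (fun e => e \in T)) /=.
  by apply: leq_trans (leq_addr _ _); apply: eq_leq; apply: eq_bigl => e; rewrite inE.
Qed.

End Run.

(** * Decoding the mask *)

Lemma modn_pow2S x t : x %% 2 ^ t.+1 = odd (x %/ 2 ^ t) * 2 ^ t + x %% 2 ^ t.
Proof.
have P0 : 0 < 2 ^ t by rewrite expn_gt0.
have lt := ltn_pmod x P0.
rewrite {1}(divn_eq x (2 ^ t)) -{1}(odd_double_half (x %/ 2 ^ t)).
have -> : ((odd (x %/ 2 ^ t)) + (x %/ 2 ^ t)./2.*2) * 2 ^ t + x %% 2 ^ t =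
    (x %/ 2 ^ t)./2 * 2 ^ t.+1 + (odd (x %/ 2 ^ t) * 2 ^ t + x %% 2 ^ t).
  by rewrite expnS; lia.
rewrite modnMDl modn_small // expnS.
by case: (odd _); lia.
Qed.

(** Labels are distinct, so the mask is the characteristic vector of [A] in binary. Larger labels
    and the cost contribute multiples of [2 ^ (label e).+1], and smaller labels sum to less than
    [2 ^ label e]. *)
Lemma odd_weight (S : finType) (c : S -> nat) (A : {set S}) (e : S) :
  odd (weight (cost_mask c) A %/ 2 ^ label e) = (e \in A).
Proof.
set l := label e; have P0 : 0 < 2 ^ l by rewrite expn_gt0.
pose low := \sum_(z in A | label z < l) 2 ^ label z.
pose high := \sum_(z in A | l < label z) 2 ^ (label z - l.+1).
have eqE z : (label z == l) = (z == e) by rewrite (inj_eq (@label_inj S)).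
have maskE : mask A = high * 2 ^ l.+1 + (e \in A) * 2 ^ l + low.
  rewrite /mask (bigID (fun z => label z < l)) /= -/low addnC; congr (_ + _).
  rewrite (bigID (fun z => z == e)) /= addnC; congr (_ + _).
    rewrite /high big_distrl /=; apply: eq_big => [z|z /andP[/andP[_ le] ne]].
      by rewrite -eqE -leqNgt -andbA; case: ltngtP.
    rewrite -expnD subnK //; move: le; rewrite -leqNgt leq_eqVlt eq_sym eqE (negPf ne) //.
  have [eA|neA] := boolP (e \in A).
    rewrite mul1n (big_pred1 e) // => z /=; case: eqP => [->|_]; last by rewrite andbF.
    by rewrite eA ltnn.
  by rewrite mul0n big_pred0 // => z; case: eqP => [->|_]; rewrite ?andbF ?(negPf neA).
have lt := label_lt e.
have lowlt : low < 2 ^ l.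
  apply: leq_ltn_trans (sum_pow2 l); rewrite (big_ord_widen #|S| (fun i => 2 ^ i) (ltnW lt)).
  rewrite (reindex (@enum_rank S)) /=; last by apply: onW_bij; apply: enum_rank_bij.
  rewrite [X in _ <= X](bigID (fun z => z \in A)) /=.
  by apply: leq_trans (leq_addr _ _); apply: eq_leq; apply: eq_bigl => z; rewrite andbC.
rewrite weight_cost_mask maskE -[X in _ * 2 ^ X](subnK lt) -/l.
set C := \sum_(_ in A) _.
have -> : C * 2 ^ (#|S| - l.+1 + l.+1) + (high * 2 ^ l.+1 + (e \in A) * 2 ^ l + low) =
    ((C * 2 ^ (#|S| - l.+1) + high) * 2 + (e \in A)) * 2 ^ l + low.
  by rewrite expnD expnS !mulnDl !mulnA !addnA -!mulnA [2 * 2 ^ l]mulnC.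
rewrite divnMDl // divn_small // addn0.
by rewrite oddD oddM andbF oddb.
Qed.

Lemma wp_powers s x free : reg s rOne = 1 -> reg s rG = x.+1 -> reg s rpw = 1 ->
  reg s rc = 0 -> reg s rp = free -> reg s rD = x.+1 - 1 ->
  wp (While rD power_body) s (fun t s' => [/\ t <= nbits x * 7 + 1, reg s' rc = nbits x,
    reg s' rp = free + nbits x & forall j, j < nbits x -> mem s' (free + j) = 2 ^ j]).
Proof.
move=> h1 hG hpw hc hp hD.
apply: wp_conseq (wp_while (m := nbits x) (T := fun=> 6) (Inv := fun i s' =>
  [/\ reg s' rpw = 2 ^ i, reg s' rc = i, reg s' rp = free + i, reg s' rD = x.+1 - 2 ^ i &
      forall j, j < i -> mem s' (free + j) = 2 ^ j]) _ _ _) _.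
- by split=> //; rewrite addn0.
- by move=> s1 _ [_ _ _ -> _]; have := nbits_gt x; lia.
- move=> i s1 lt fr [gpw gc gp gD gm]; split; first by rewrite gD; have := nbits_le lt; lia.
  apply: wp_block; sim; frw fr; rewrite h1 hG gpw gc gp expnS mul2n addnn.
  split=> //; split=> //; rewrite ?addn1 ?addnS //.
  move=> j; rewrite ltnS leq_eqVlt => /orP[/eqP->|ji]; first by rewrite /upd eqxx.
  by rewrite /upd eqn_add2l ltn_eqF // gm.
- move=> t s1 _ [le1 [_ ? ? _ ?]]; split=> //.
  by move: le1; rewrite sum_nat_const card_ord addn1.
Qed.

(** Reversed because the machine emits positions from the top down. *)
Definition digits n x lo i : seq nat :=
  [seq j <- rev (iota lo i) | (j < n) && odd (x %/ 2 ^ j)].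

Lemma wp_digits s x free n m : reg s rOne = 1 -> reg s rc = m -> reg s rp = free + m ->
  reg s rx = x -> x < 2 ^ m -> reg s rn = n -> reg s rq = free + m -> reg s 0 = 0 ->
  reg s 1 = free + m -> (forall j, j < m -> mem s (free + j) = 2 ^ j) ->
  wp (rep rc digit_body) s (fun t s' => t <= m * 20 + 1 /\
    mkseq (fun i => mem s' (reg s' 1 + i)) (reg s' 0) = digits n x 0 m).
Proof.
move=> h1 hc hp hx xm hn hq hz ho hm.
apply: wp_conseq (wp_repc (T := 17) (Inv := fun i s' =>
  [/\ reg s' rp = free + (m - i), reg s' rx = x %% 2 ^ (m - i),
      reg s' rq = free + m + reg s' 0, forall j, j < m -> mem s' (free + j) = 2 ^ j &
      mkseq (fun j => mem s' (free + m + j)) (reg s' 0) = digits n x (m - i) i])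
  hc h1 _ _ _) _ => //.
- by rewrite subn0 hz addn0 modn_small.
- move=> i s1 lt fr rci [gp gx gq gm gd].
  set t := (m - i).-1; have tE : m - i = t.+1 by rewrite /t; lia.
  have tE' : m - i.+1 = t by rewrite /t; lia.
  have rd : mem s1 (free + t) = 2 ^ t by apply: gm; rewrite /t; lia.
  have dE : digits n x t i.+1 = if (t < n) && odd (x %/ 2 ^ t)
      then rcons (digits n x t.+1 i) t else digits n x t.+1 i.
    by rewrite /digits /= rev_cons filter_rcons.
  have P0 : 0 < 2 ^ t by rewrite expn_gt0.
  have mlt := ltn_pmod x P0.
  rewrite tE in gp gx gd.
  apply: wp_seq; apply: wp_block; sim; frw fr; rewrite gp h1 rci tE.
  have -> : free + t.+1 - 1 = free + t by lia.
  rewrite rd gx modn_pow2S subSS subn0.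
  apply: wp_if; sim => nz; last first.
    have bit : odd (x %/ 2 ^ t) = false.
      by move: nz; case: (odd _) => //; lia.
    apply: wp_skip; split=> //; sim; frw fr; rewrite tE' dE bit andbF; split=> //.
    by rewrite gx modn_pow2S bit.
  have bit : odd (x %/ 2 ^ t) by move: nz; case: (odd _) => //; lia.
  rewrite bit mul1n; apply: wp_seq; apply: wp_block; sim; frw fr; rewrite hn.
  have -> : reg s1 rx - 2 ^ t = x %% 2 ^ t by rewrite gx modn_pow2S bit; lia.
  apply: wp_if; sim => tn; last first.
    apply: wp_skip; split=> //; sim; frw fr; rewrite tE' dE.
    have -> : (t < n) = false by lia.
    by split.
  apply: wp_block; sim; frw fr; rewrite h1 tE' dE bit gq.
  have -> : (t < n) = true by lia.
  split=> //; sim; split=> //.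
  - lia.
  - by move=> j jm; rewrite /upd; case: eqP => [|_]; [lia | apply: gm].
  rewrite addn1 /= mkseqS; congr (rcons _ _); last by rewrite /upd eqxx.
  rewrite -gd; apply/eq_in_map => j; rewrite mem_iota /upd => jP.
  by case: eqP => //; lia.
- move=> t s1 fr [le1 _ [_ _ _ _ gd]]; split=> //; frw fr.
  by rewrite ho gd subnn.
Qed.

Lemma digits_weight (S : finType) (c : S -> nat) (A : {set S}) m :
  weight (cost_mask c) A < 2 ^ m ->
  perm_eq (digits #|S| (weight (cost_mask c) A) 0 m) [seq label e | e <- enum A].
Proof.
move=> lt; apply: uniq_perm.
- by rewrite filter_uniq // rev_uniq iota_uniq.
- by rewrite map_inj_uniq ?enum_uniq //; apply: label_inj.
move=> j; rewrite mem_filter mem_rev mem_iota add0n.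
apply/idP/mapP => [/andP[/andP[jS od] _]|[e eA ->]].
  pose e := enum_val (Ordinal jS); have le : label e = j by rewrite /label enum_valK.
  by exists e; rewrite ?le // mem_enum -(odd_weight c) le.
rewrite mem_enum in eA; rewrite label_lt odd_weight eA /= ltnNge; apply/negP => le.
have := odd_weight c A e; rewrite eA divn_small //; apply: leq_trans lt _.
by rewrite leq_exp2l.
Qed.

Lemma wp_decode s (S : finType) (c : S -> nat) (A : {set S}) K b : reg s rOne = 1 ->
  reg s rZero = 0 -> reg s rK = K -> reg s rBest = b -> reg s rn = #|S| -> reg s 0 = 0 ->
  b = K - weight (cost_mask c) A -> b != 0 ->
  wp decode s (fun t s' => t <= nbits K * 27 + 12 /\
    perm_eq (mkseq (fun i => mem s' (reg s' 1 + i)) (reg s' 0)) [seq label e | e <- enum A]).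
Proof.
move=> h1 h0 hK hb hn hz bE nb; set x := weight _ _ in bE.
have xE : K - b = x by rewrite bE in nb *; lia.
apply: wp_seq; apply: wp_block; sim; rewrite hK hb h0 h1 xE addn0 addn1; set s1 := State _ _.
apply: wp_seq; apply: wp_conseq (wp_powers (s := s1) (x := x) (free := reg s rFree)
  _ _ _ _ _ _) _ => //.
move=> t2 s2 fr2 [le2 c2 p2 m2].
apply: wp_seq; apply: wp_block; sim; frw fr2; rewrite /s1; sim; rewrite h0 addn0.
set s3 := State _ _.
apply: wp_conseq (wp_digits (s := s3) (x := x) (free := reg s rFree) (n := #|S|)
  (m := nbits x) _ _ _ _ (nbits_gt x) _ _ _ _ _) _ => //; rewrite ?/s3; sim; frw fr2;
  rewrite /s1; sim => //.
move=> t4 s4 _ [le4 ->]; split; last exact: digits_weight (nbits_gt x).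
have : nbits x <= nbits K.
  by apply: nbits_leq; apply: ltn_trans (nbits_gt K); rewrite -xE in nb *; lia.
by lia.
Qed.

(** * Initialisation *)

Section Setup.

Variables (I : blm) (Fs : seq {set ground I}) (a b : nat) (x0 : ground I).
Hypothesis a_gt0 : 0 < a.
Hypothesis lt_ab : a < b.

Local Notation n := #|ground I|.
Local Notation mI := (nth 0 [:: a, b & encode Fs]).
(** The ceiling of [b / a], that is of [1/eps]. *)
Local Notation k := ((b.-1 %/ a).+1).

Lemma sum_profits : \sum_(0 <= j < n) mI (6 + j.*2) = total_profit [set: ground I].
Proof.
rewrite big_mkord (reindex (@enum_rank (ground I))) /=; last first.
  by apply: onW_bij; apply: enum_rank_bij.
rewrite /total_profit; apply: eq_big => [e|e _]; first by rewrite inE.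
exact: (encode_profit Fs a b x0).
Qed.

Lemma wp_setup s : reg s rOne = 1 -> reg s rZero = 0 -> reg s rA = a ->
  reg s rD = b - a -> reg s rH = 0 -> mem s = mI ->
  wp setup s (fun t s' => [/\ t <= 9 * k + 15 * n + 10 * size Fs + 60,
    static Fs k s' & guess_inv Fs a b k 1 s']).
Proof.
move=> h1 h0 hA hD hH hm.
apply: wp_seq; apply: wp_block; sim; rewrite hm h1.
have -> : mI 2 = n by [].
have -> : mI 3 = size Fs by [].
have -> : mI 4 = budget I by [].
set s1 := State _ _.
apply: wp_seq; apply: wp_conseq (wp_while (s := s1) (m := b.-1 %/ a) (T := fun=> 3)
  (Inv := fun i s' => reg s' rD = b - i.+1 * a /\ reg s' rk = i.+1) _ _ _) _.
- by rewrite mul1n.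
- move=> s2 _ [-> _]; have := ltn_ceil b.-1 a_gt0; lia.
- move=> i s2 lt fr [gD gk]; split.
    have : i.+1 * a <= b.-1 %/ a * a by rewrite leq_mul2r lt orbT.
    by have := leq_trunc_div b.-1 a; lia.
  apply: wp_block; sim; frw fr; rewrite /s1; sim; rewrite h1 hA gD gk; split=> //.
  by split; lia.
move=> t2 s2 fr2 [le2 [_ k2]]; rewrite sum_nat_const card_ord in le2.
apply: wp_seq; apply: wp_block; sim; rewrite k2; frw fr2; rewrite /s1; sim; rewrite h0 addn0.
set s3 := State _ _.
apply: wp_seq; apply: wp_conseq (wp_mul_loop (s := s3) _ _) _ => //.
  by rewrite /s3; sim; frw fr2.
move=> t4 s4 fr4 [le4 H4 _]; move: le4 H4; rewrite /s3; sim; frw fr2; rewrite /s1; sim.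
rewrite hH add0n => le4 H4.
apply: wp_seq; apply: wp_block; sim; rewrite H4; frw fr4; rewrite /s3; sim; frw fr2.
rewrite /s1; sim; rewrite h0 h1 addn0; set s5 := State _ _.
apply: wp_seq; apply: wp_conseq (wp_dbl_loop (s := s5) _ _) _ => //.
  by rewrite /s5; sim; frw fr4; rewrite /s3; sim; frw fr2.
move=> t6 s6 fr6 [le6 K6 _]; move: le6 K6.
rewrite /s5; sim; frw fr4; rewrite /s3; sim; frw fr2; rewrite /s1; sim => le6 K6.
apply: wp_seq; apply: wp_block; sim; frw fr6; rewrite /s5; sim; frw fr4; rewrite /s3; sim.
frw fr2; rewrite /s1; sim; rewrite h0 addn0; set s7 := State _ _.
have m7 : mem s7 = mI by rewrite /s7; sim.
have one7 : reg s7 rOne = 1.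
  by rewrite /s7; sim; frw fr6; rewrite /s5; sim; frw fr4; rewrite /s3; sim; frw fr2.
have two7 : reg s7 rTwo = 2.
  by rewrite /s7; sim; frw fr6; rewrite /s5; sim; frw fr4; rewrite /s3; sim; frw fr2.
apply: wp_seq; apply: wp_conseq (wp_repc (s := s7) (m := n) (T := 4) (Inv := fun i s' =>
  reg s' rp = 6 + i.*2 /\ reg s' rSum = (\sum_(0 <= j < i) mI (6 + j.*2)).+1)
  _ one7 _ _ _) _ => //.
- by rewrite big_geq.
- move=> i s8 lt fr _ [gp gS]; apply: wp_block; sim; frw fr.
  rewrite m7 two7 gp gS big_nat_recr //=; split=> //; split; first by lia.
  by rewrite addSn.
move=> t8 s8 fr8 [le8 _ [p8]]; rewrite sum_profits => S8.
apply: wp_seq; apply: wp_block; sim; rewrite p8; frw fr8; rewrite one7 /s7; sim; frw fr6.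
rewrite /s5; sim; frw fr4; rewrite /s3; sim; frw fr2; rewrite /s1; sim; rewrite h0 !addn0.
have -> : 6 + n.*2 - 1 = offset Fs 0 by rewrite /offset take0 big_nil; lia.
set s9 := State _ _.
have m9 : mem s9 = mI by rewrite /s9; sim; frw fr8.
have one9 : reg s9 rOne = 1 by rewrite /s9; sim; frw fr8.
have two9 : reg s9 rTwo = 2 by rewrite /s9; sim; frw fr8.
apply: wp_seq; apply: wp_conseq (wp_repc (s := s9) (m := size Fs) (T := 5) (Inv := fun i s' =>
  reg s' rp = offset Fs i) _ one9 _ _ _) _ => //.
- move=> i s10 lt fr _ gp; apply: wp_block; sim; frw fr.
  rewrite m9 two9 one9 gp; have [_ -> _] := encode_layout a b x0 lt.
  by rewrite offsetS //; split=> //; lia.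
move=> t10 s10 fr10 [le10 _ p10].
have HE : k * n = n * k by rewrite mulnC.
have WE : k * n + k * n + 1 = (n * k).*2.+1 by rewrite HE addnn addn1.
have ThE : k * n - n = n * k.-1 by rewrite /= mulSn addKn mulnC.
have [[g1 g0 gf gn] [gK gW gH gV] [gTh gSum gSets]] :
  [/\ [/\ reg s10 rOne = 1, reg s10 rZero = 0, reg s10 rf = size Fs & reg s10 rn = n],
      [/\ reg s10 rK = (budget I).+1 * 2 ^ n, reg s10 rW = (n * k).*2.+1,
          reg s10 rH = n * k & reg s10 rV = (n * k).*2] &
      [/\ reg s10 rTh = n * k.-1, reg s10 rSum = (total_profit [set: ground I]).+1 &
          reg s10 rSets = offset Fs 0]].
  split; split; frw fr10; rewrite /s9; sim; rewrite ?S8; frw fr8; rewrite /s7; sim;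
    rewrite ?K6; frw fr6; rewrite /s5; sim; rewrite ?H4; frw fr4; rewrite /s3; sim;
    frw fr2; rewrite /s1; sim; rewrite ?WE ?ThE ?HE ?addnn //.
  by rewrite addn1.
have m10 : mem s10 = mI by frw fr10.
clear fr10 fr8 fr6 fr4 fr2.
apply: wp_block; sim; rewrite p10 g0 gn gSum !addn0; split.
- by move: le2 le4 le6 le8 le10; clear; lia.
- by split; rewrite /scan_regs; sim; rewrite ?g1 ?g0 ?gf ?gn ?gK ?gW ?gH ?gV ?gTh ?gSum ?gSets.
split; sim; rewrite ?m10 ?gK //.
- move=> x le; apply: nth_default; rewrite size_input; lia.
- exact: best_ok1.
Qed.

End Setup.

(** * Bounds in terms of the encoding size *)

Lemma bit_length_gt x : x < 2 ^ bit_length x.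
Proof. by rewrite /bit_length trunc_log_ltn. Qed.

Lemma sum_lt_pow2 (T : Type) (r : seq T) (f : T -> nat) :
  \sum_(x <- r) f x < 2 ^ \sum_(x <- r) bit_length (f x).
Proof.
elim: r => [|x r IH]; first by rewrite !big_nil.
rewrite !big_cons expnD; have := leq_mul (bit_length_gt (f x)) IH.
by move: (2 ^ _ * _) (\sum_(_ <- _) f _) => q u; lia.
Qed.

Section EncodingSize.

Variables (I : blm) (Fs : seq {set ground I}).
Local Notation n := #|ground I|.
Local Notation N := (encoding_size (encode Fs)).

Lemma size_le_encoding_size (w : seq nat) : size w <= encoding_size w.
Proof. by rewrite -sum1_size; apply: leq_sum. Qed.

Lemma size_encode : (size (encode Fs)).+2 = offset Fs (size Fs).
Proof. exact: (size_input Fs 0 0). Qed.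

Lemma encoding_size_facts :
  [/\ n <= N, size Fs <= N, \sum_(X <- Fs) #|X| <= N & 0 < N].
Proof.
have := size_le_encoding_size (encode Fs); have := size_encode.
rewrite /offset take_size big_split /= big_const_seq count_predT iter_addn_0.
move: (\sum_(_ <- _) _) (size (encode Fs)) (encoding_size _) => u v w; split; lia.
Qed.

(** Every cost has at least one digit, and these digits pay for [n]. Strictness is needed in
    [nbits_weights], where the factor [budget + 1] may cost one more digit. *)
Lemma encoding_size_numbers :
  bit_length (budget I) + n + \sum_(e <- enum (ground I)) bit_length (@profit I e) < N.
Proof.
rewrite /encoding_size /encode !big_cat /= !big_cons big_nil addn0 big_flatten big_map.
rewrite [X in _ < _ + (X + _)](eq_bigr (fun e => bit_length (@cost I e) +
  bit_length (@profit I e))); last by move=> e _; rewrite big_cons big_seq1.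
rewrite big_split /=.
have : n <= \sum_(e <- enum (ground I)) bit_length (@cost I e).
  by rewrite cardE -sum1_size; apply: leq_sum.
move: (\sum_(e <- _) bit_length (cost e)) (\sum_(e <- _) bit_length (profit e)) (\sum_(_ <- flatten _) _) => x y z.
move: (bit_length (budget I)) (bit_length (size Fs)) => u v le.
set p := bit_length _; have : 0 < p by [].
move: p; move: {+}n le => q le p.
by lia.
Qed.

(** Bounds the number of guesses: a sum has at most as many digits as its summands together. *)
Lemma nbits_profits : nbits (total_profit [set: ground I]) <= N.
Proof.
apply: leq_trans (ltnW encoding_size_numbers); apply: leq_trans (leq_addl _ _).
apply: nbits_leq; rewrite /total_profit -big_enum.
have -> : enum [set: ground I] = enum (ground I) by apply: eq_enum => e; rewrite inE.
exact: sum_lt_pow2.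
Qed.

Lemma nbits_weights : nbits ((budget I).+1 * 2 ^ n) <= N.
Proof.
apply: leq_trans encoding_size_numbers; rewrite -addnA.
apply: leq_trans (_ : (bit_length (budget I) + n).+1 <= _); last by lia.
apply: nbits_leq; rewrite expnS mul2n -addnn expnD.
have : (budget I).+1 * 2 ^ n <= 2 ^ bit_length (budget I) * 2 ^ n.
  by rewrite leq_mul2r bit_length_gt orbT.
have : 0 < 2 ^ bit_length (budget I) * 2 ^ n by rewrite muln_gt0 !expn_gt0.
by lia.
Qed.

End EncodingSize.

(** * Assembling the running time and the approximation ratio *)

Lemma wp_main (I : blm) (Fs : seq {set ground I}) (a b : nat) (r : nat -> nat) :
  perm_eq Fs (enum (fam I)) -> 0 < a -> a < b -> (forall i, r i = 0) ->
  let k := (b.-1 %/ a).+1 in let N := encoding_size (encode Fs) in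
  wp main (State r (nth 0 [:: a, b & encode Fs])) (fun t s =>
    t <= 4500 * (N ^ 5 * k ^ 2) /\ exists T : {set ground I},
      [/\ outputs s T, solution T & k.-1 * OPT I <= k * total_profit T]).
Proof.
move=> permF a0 ab r0 k N.
have [nN fN XN N0] := encoding_size_facts Fs.
have [x0 _] : exists x0 : ground I, x0 \in [set: ground I].
  by apply/card_gt0P; rewrite cardsT ground_gt0.
apply: wp_seq; apply: wp_block; sim; rewrite !r0 /=; set s1 := State _ _.
apply: wp_if; rewrite /s1; sim; last by lia.
move=> _; apply: wp_seq.
apply: wp_conseq (wp_setup x0 a0 ab _ _ _ _ _ _) _ => //; sim; rewrite ?r0 //.
move=> t2 s2 fr2 [le2 st2 I2].
apply: wp_seq; apply: wp_conseq (wp_guesses x0 permF _ nN fN XN st2 I2) _ => //.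
move=> t3 s3 fr3 [le3 [A [sA bE nb ok]]].
have [[[h1 h0 _] _ _ [hK _] _] [hn _ _] _ _] := st2.
apply: wp_conseq (wp_decode (s := s3) (A := A) (c := @cost I) _ _ erefl erefl _ _ _ nb) _;
  frw fr3; rewrite ?hK //.
  by frw fr2; sim.
move=> t4 s4 _ [le4 out]; split; last by exists A.
have := nbits_profits Fs; have := nbits_weights Fs; rewrite -/N => nw np.
have W3 : (#|ground I| * k).*2.+1 <= 3 * (N * k).
  have : #|ground I| * k <= N * k by rewrite leq_mul2r nN orbT.
  have : 0 < N * k by rewrite muln_gt0 N0.
  by lia.
(* At most [N] guesses at [450 * (N W)^2] each, with [W <= 3 N k], give [450 * 9 = 4050]; the other
   450 cover setup, decoding and loop overhead. *)
have sq : N * (450 * (N * (#|ground I| * k).*2.+1) ^ 2) <= 4050 * (N ^ 5 * k ^ 2).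
  apply: leq_trans (_ : N * (450 * (N * (3 * (N * k))) ^ 2) <= _).
    by rewrite !leq_mul2l leq_sqr leq_mul2l W3 !orbT.
  by rewrite !expnMn !expnS !expn0; lia.
have kN : k <= N ^ 5 * k ^ 2 by rewrite -[k ^ 2]mulnn mulnA leq_pmull // muln_gt0 expn_gt0 N0.
have NN : N <= N ^ 5 * k ^ 2.
  rewrite expnS -mulnA leq_pmulr // muln_gt0 !expn_gt0 N0 //.
have t3le : t3 <= N * (450 * (N * (#|ground I| * k).*2.+1) ^ 2) + N + 1.
  apply: leq_trans le3 _; rewrite leq_add2r -mulnSr addn1 leq_mul2r np orbT //.
by move: le2 t3le le4 sq; move: (N * _) (N ^ 5 * _) kN NN => u v; rewrite -/k; lia.
Qed.

Theorem theorem1p3 :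
  exists (P : program) (C : nat),
    forall (I : blm) (w : seq nat) (eps : rat),
      encodes I w -> (0 < eps)%R ->
      exists (t : nat) (s : state) (T : {set ground I}),
        [/\ exec P (input w eps) t s,
            (t%:R <= C%:R * ((encoding_size w)%:R ^+ 5 * eps ^- 2 + 1) :> rat)%R,
            outputs s T,
            solution T &
            ((1 - eps) * (OPT I)%:R <= (total_profit T)%:R)%R].
Proof.
(* An opaque copy of the constant keeps the numeral from being unfolded in unary. *)
have [c cE] : exists c : nat, c = 4500 by exists 4500.
(* For [eps < 1] one has [k <= 2 / eps], whence the factor 4 on [k ^ 2]; 7 bounds the run that stops
   at once when [eps >= 1]. *)
exists main, (c * 4 + 7) => I w eps [Fs permF ->] eps0.
set a := `|numq eps|%N; set b := `|denq eps|%N.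
have a0 : 0 < a by rewrite absz_gt0 numq_eq0 gt_eqF.
have b0 : 0 < b by rewrite absz_gt0 denq_eq0.
have epsE : eps = (a%:R / b%:R)%R.
  rewrite -{1}[eps]divq_num_den !pmulrn !gez0_abs ?denq_ge0 //.
  by rewrite numq_ge0 ltW.
have aR : (0 < a%:R :> rat)%R by rewrite ltr0n.
have bR : (0 < b%:R :> rat)%R by rewrite ltr0n.
set N := encoding_size _.
(* If [eps >= 1], the required profit is at most 0: the program leaves register 0 at 0, which
   outputs the empty set. *)
have [ab|ba] := ltnP a b; last first.
  have : wp main (input (encode Fs) eps) (fun t s => t <= 7 /\ reg s 0 = 0).
    apply: wp_seq; apply: wp_block; sim; rewrite /= -/a -/b.
    apply: wp_if; sim; first by lia.
    by move=> _; apply: wp_skip.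
  move=> [t [s [ex [le7 out]]]]; exists t, s, set0; split.
  - exact: ex.
  - apply: (@le_trans _ _ (c * 4 + 7)%:R%R); first by rewrite ler_nat; lia.
    rewrite ler_peMr ?ler0n // lerDr mulr_ge0 ?exprn_ge0 ?ler0n //.
    by rewrite invr_ge0 exprn_ge0 ?ltW.
  - by rewrite /outputs out enum_set0.
  - rewrite /solution /total_cost big_set0 andbT.
    by apply/forall_inP => X _; rewrite set0I cards0.
  - rewrite /total_profit big_set0 mulr_le0_ge0 ?ler0n // subr_le0 epsE.
    by rewrite ler_pdivlMr // mul1r ler_nat.
have [t [s [ex [le [T [out sT ok]]]]]] := wp_main permF a0 ab (fun=> erefl 0).
exists t, s, T; split=> //.
- rewrite -/N -cE in le.
  set k := (b.-1 %/ a).+1 in le ok.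
  have kab : k * a <= 2 * b.
    by have := leq_trunc_div b.-1 a; rewrite /k mulSn; lia.
  have kR : (k%:R <= 2 * eps^-1 :> rat)%R.
    by rewrite epsE invf_div mulrA ler_pdivlMr // -!natrM ler_nat.
  have k2R : ((k ^ 2)%:R <= 4 * eps ^- 2 :> rat)%R.
    have -> : (4 * eps ^- 2 = (2 * eps^-1) ^+ 2 :> rat)%R by rewrite exprMn exprVn -natrX.
    rewrite natrX; apply: lerXn2r; rewrite ?nnegrE ?ler0n //.
    by rewrite mulr_ge0 // invr_ge0 ltW.
  apply: (@le_trans _ _ (c * (N ^ 5 * k ^ 2))%:R%R); first by rewrite ler_nat.
  rewrite natrM natrM natrX.
  apply: (@le_trans _ _ (c%:R * (N%:R ^+ 5 * (4 * eps ^- 2)))%R).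
    by rewrite ler_wpM2l ?ler0n // ler_wpM2l ?exprn_ge0 ?ler0n.
  have Y0 : (0 <= N%:R ^+ 5 * eps ^- 2 :> rat)%R.
    by rewrite mulr_ge0 ?exprn_ge0 ?ler0n // invr_ge0 exprn_ge0 ?ltW.
  rewrite mulrCA [(c%:R * _)%R]mulrA -natrM mulrCA.
  apply: ler_pM; rewrite ?ler0n ?ler_nat //; last by rewrite lerDl.
  exact: leq_addr.
- set k := (b.-1 %/ a).+1 in le ok.
  have kab : b <= k * a by have := ltn_ceil b.-1 a0; rewrite -/k; lia.
  have k0 : (0 < k%:R :> rat)%R by rewrite ltr0n.
  have ke : (1 <= k%:R * eps :> rat)%R.
    by rewrite epsE mulrA ler_pdivlMr // mul1r -natrM ler_nat.
  (* After multiplication by [k], the bound [1 <= k * eps] gives [k * (1 - eps) <= k - 1], which is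
     the ratio already proved. *)
  rewrite -(ler_pM2l k0) mulrA.
  apply: (@le_trans _ _ (k.-1 * OPT I)%:R%R); last by rewrite -natrM ler_nat.
  rewrite natrM ler_wpM2r ?ler0n // mulrBr mulr1 lerBlDr.
  by apply: (@le_trans _ _ (k.-1%:R + 1)%R); [rewrite natr1 | rewrite lerD2l].
Qed.
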